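(* The mechanical billiard systems whose underlying mechanical system is the Lagrange problem (with arbitrary real parameters $m_1,m_2,f$) in the plane, on the sphere, or in the hyperbolic plane, and whose reflection wall is any combination of confocal conic sections with foci at the two Kepler centers $Z_1,Z_2$, are integrable.
   Context: A two-dimensional mechanical billiard system $(M,g,U,\mathcal B)$ consists of a two-dimensional Riemannian manifold $(M,g)$, a force function $U$ that is smooth on an open dense subset of $M$, and a piecewise smooth curve $\mathcal B\subset M$ (the reflection wall). A particle moves according to $\nabla_{\dot q}\dot q=\nabla U(q)$ and is reflected elastically at $\mathcal B$: at the reflection point the tangential component of the velocity is unchanged and the normal component changes sign. The total energy is $E(q,\dot q)=\frac12 g_q(\dot q,\dot q)-U(q)$; it is invariant under reflections. The billiard is called integrable if there is an additional first integral, i.e. a first integral of the underlying mechanical system which is invariant under the reflections at $\mathcal B$ and functionally independent of $E$. It is not required that the billiard mapping be well defined everywhere. Lagrange problems, with parameters $m_1,m_2,f\in\mathbb R$ of any sign (possibly zero), and Kepler centers $Z_1\neq Z_2$: (i) Plane: $M=\mathbb R^2$ with the Euclidean metric and $U(q)=\dfrac{m_1}{\|q-Z_1\|}+\dfrac{m_2}{\|q-Z_2\|}+f\left\|q-\dfrac{Z_1+Z_2}{2}\right\|^2$. (ii) Sphere: $M=\mathcal S$ the unit sphere in $\mathbb R^3$ with the round metric and $U=m_1\cot\theta_{Z_1}+m_2\cot\theta_{Z_2}+f\tan^2\theta_{Z_{mid}}$, where $Z_1,Z_2\in\mathcal S$, $Z_2\notin\{Z_1,-Z_1\}$, $Z_{mid}$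 is the middle point of $Z_1$ and $Z_2$ (on the minimizing geodesic), and $\theta_P$ is the central angle from the moving particle to the point $P$. (iii) Hyperbolic plane: $M$ is a sheet of the hyperboloid $\{x^2+y^2-z^2=-1\}$ in Minkowski space $\mathbb R^{2,1}$ with the metric induced by $dx^2+dy^2-dz^2$, and $U=m_1\coth\theta_{Z_1}+m_2\coth\theta_{Z_2}+f\tanh^2\theta_{Z_{mid}}$, where $Z_1,Z_2$ lie on that sheet, $Z_{mid}$ is their midpoint, and $\theta_P$ is the hyperbolic central angle (hyperbolic distance) from the moving particle to $P$. In each of these spaces, with $d$ the Riemannian distance, the conic sections with foci $Z_1,Z_2$ are the ellipses $\{q: d(q,Z_1)+d(q,Z_2)=c\}$ and hyperbolas $\{q:|d(q,Z_1)-d(q,Z_2)|=c\}$. A combination of confocal conic sections is a piecewise smooth curve each of whose smooth pieces lies on a conic section with these same two foci. *)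

(* Defs.v *)
From HB Require Import structures.
From mathcomp Require Import all_boot all_order all_algebra.
From mathcomp Require Import all_classical all_reals all_analysis.

Set Implicit Arguments.
Unset Strict Implicit.
Unset Printing Implicit Defensive.

Import Order.TTheory GRing.Theory Num.Theory.
Import numFieldNormedType.Exports.

Local Open Scope classical_set_scope.
Local Open Scope ring_scope.

(* For finite-dimensional [V], [forall k, Ck k O f] is C^oo on the open set O. *)
Fixpoint Ck (R : realType) (V W : normedModType R) (k : nat) (O : set V)
    (f : V -> W) : Prop :=
  match k with
  | 0%N => forall x, O x -> {for x, continuous f}
  | k'.+1 => (forall x, O x -> differentiable f x) /\
             (forall v, Ck k' O ('D_v f : V -> W))
  end.

(* Smoothness on a subset (an embedded submanifold, or an interval with its
   end points): existence of a smooth extension to an open neighbourhood. *)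
Definition smooth_near (R : realType) (V W : normedModType R) (A : set V)
    (f : V -> W) : Prop :=
  exists O : set V, [/\ open O, A `<=` O & forall k, Ck k O f].

(* [c] is a curve in [A] through [p] at time 0 with velocity [w]. *)
Definition curve_at (R : realType) (V : normedModType R) (A : set V)
    (p w : V) (c : R -> V) : Prop :=
  [/\ c 0 = p, \forall t \near (0 : R), A (c t) & is_derive (0 : R) 1 c w].

Definition tangent (R : realType) (V : normedModType R) (A : set V)
    (p w : V) : Prop := exists c, curve_at A p w c.

(* A mechanical system on a surface embedded in R^n. The Riemannian metric of [space] is
   induced by the ambient symmetric
   bilinear form [metric], which need not be positive definite on R^n.
   [regular] is the open dense subset of [space] on which the force function
   is smooth; [force] is only ever used through its values on [regular]. *)

Record mech_system (R : realType) (n : nat) := MechSystem {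
  metric : 'rV[R]_n -> 'rV[R]_n -> R;
  space : set 'rV[R]_n;
  regular : set 'rV[R]_n;
  force : 'rV[R]_n -> R }.

Section MechanicalSystems.
Variables (R : realType) (n : nat).
Notation V := 'rV[R]_n.
Variable S : mech_system R n.

Definition phase : set (V * V) :=
  [set p | regular S p.1 /\ tangent (space S) p.1 p.2].

Definition energy (p : V * V) : R := metric S p.2 p.2 / 2 - force S p.1.

Definition is_gradient (q a : V) : Prop :=
  tangent (space S) q a /\
  forall w c, curve_at (space S) q w c ->
    is_derive (0 : R) 1 (force S \o c) (metric S a w).

(* For a submanifold with the induced metric, the covariant derivative of q'
   along q is the tangential part of the ambient acceleration. *)
Definition is_covariant_acceleration (q : R -> V) (t : R) (a : V) : Prop :=
  tangent (space S) (q t) a /\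
  forall w, tangent (space S) (q t) w -> metric S (derive1 (derive1 q) t - a) w = 0.

Definition solution (J : set R) (q : R -> V) : Prop :=
  forall t, J t ->
    [/\ regular S (q t), derivable q t 1, derivable (derive1 q) t 1 &
        exists a, is_covariant_acceleration q t a /\ is_gradient (q t) a].

Definition first_integral (G : V * V -> R) : Prop :=
  smooth_near phase G /\
  forall (J : set R) (q : R -> V), open J -> is_interval J -> solution J q ->
    forall s t, J s -> J t -> G (q s, derive1 q s) = G (q t, derive1 q t).

(* dF /\ dG does not vanish at p, as a 2-form on the tangent space at p to the
   tangent bundle of the regular set. *)
Definition independent_at (F G : V * V -> R) (p : V * V) : Prop :=
  exists w1 w2 c1 c2 (f1 f2 g1 g2 : R),
    [/\ curve_at phase p w1 c1, curve_at phase p w2 c2,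
        is_derive (0 : R) 1 (F \o c1) f1 /\ is_derive (0 : R) 1 (G \o c1) g1,
        is_derive (0 : R) 1 (F \o c2) f2 /\ is_derive (0 : R) 1 (G \o c2) g2 &
        f1 * g2 - f2 * g1 != 0].

Definition functionally_independent (F G : V * V -> R) : Prop :=
  phase `<=` closure [set p | phase p /\ independent_at F G p].

End MechanicalSystems.

(* A wall is the union of the arcs [wall_map i @` wall_dom i]. *)
Record wall (R : realType) (n : nat) := Wall {
  wall_piece : Type;
  wall_dom : wall_piece -> set R;
  wall_map : wall_piece -> R -> 'rV[R]_n }.

Section Billiards.
Variables (R : realType) (n : nat).
Notation V := 'rV[R]_n.

(* A regular smooth curve on a nondegenerate interval, with or without its
   end points. *)
Definition smooth_arc (M : set V) (J : set R) (c : R -> V) : Prop :=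
  [/\ is_interval J, J° !=set0, smooth_near J c &
      forall t, J t -> M (c t) /\ derive1 c t != 0].

Definition piecewise_smooth (M : set V) (B : wall R n) : Prop :=
  (forall i : wall_piece B, smooth_arc M (wall_dom i) (wall_map i)) /\
  (forall q, M q -> exists2 W : set V, nbhs q W &
    finite_set [set i : wall_piece B | exists2 t, wall_dom i t & W (wall_map i t)]).

Definition tangential (g : V -> V -> R) (e v : V) : V := (g v e / g e e) *: e.

Definition reflection (g : V -> V -> R) (e v : V) : V :=
  tangential g e v - (v - tangential g e v).

(* At a point lying on several pieces, invariance is required for the reflection
   at each of them. *)
Definition reflection_invariant (S : mech_system R n) (B : wall R n)
    (G : V * V -> R) : Prop :=
  forall (i : wall_piece B) (t : R) (v : V),
    wall_dom i t -> phase S (wall_map i t, v) ->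
    G (wall_map i t, reflection (metric S) (derive1 (wall_map i) t) v)
    = G (wall_map i t, v).

Definition integrable_billiard (S : mech_system R n) (B : wall R n) : Prop :=
  exists G : V * V -> R,
    [/\ first_integral S G, reflection_invariant S B G &
        functionally_independent S (energy S) G].

Definition ellipse (M : set V) (d : V -> V -> R) (Z1 Z2 : V) (c : R) : set V :=
  [set q | M q /\ d q Z1 + d q Z2 = c].

Definition hyperbola (M : set V) (d : V -> V -> R) (Z1 Z2 : V) (c : R) : set V :=
  [set q | M q /\ `|d q Z1 - d q Z2| = c].

Definition conic_with_foci (M : set V) (d : V -> V -> R) (Z1 Z2 : V)
    (C : set V) : Prop :=
  exists c, C = ellipse M d Z1 Z2 c \/ C = hyperbola M d Z1 Z2 c.

Definition confocal_combination (M : set V) (d : V -> V -> R) (Z1 Z2 : V)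
    (B : wall R n) : Prop :=
  piecewise_smooth M B /\
  forall i : wall_piece B, exists2 C, conic_with_foci M d Z1 Z2 C &
    forall t, wall_dom i t -> C (wall_map i t).

Definition midpoint (M : set V) (d : V -> V -> R) (Z1 Z2 Zm : V) : Prop :=
  [/\ M Zm, d Zm Z1 = d Z1 Z2 / 2 & d Zm Z2 = d Z1 Z2 / 2].

End Billiards.

Definition dot (R : realType) (n : nat) (u v : 'rV[R]_n) : R :=
  \sum_(i < n) u 0 i * v 0 i.

(* [`|_|] on row vectors is the sup norm, hence this definition. *)
Definition euclid_norm (R : realType) (n : nat) (u : 'rV[R]_n) : R :=
  Num.sqrt (dot u u).

Definition euclid_dist (R : realType) (n : nat) (p q : 'rV[R]_n) : R :=
  euclid_norm (p - q).

Definition sphere (R : realType) : set 'rV[R]_3 := [set q | dot q q = 1].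

(* Central angle, which is the Riemannian distance of the unit sphere. *)
Definition sphere_dist (R : realType) (p q : 'rV[R]_3) : R := acos (dot p q).

Definition minkowski (R : realType) (u v : 'rV[R]_3) : R :=
  u 0 0 * v 0 0 + u 0 1 * v 0 1 - u 0 2 * v 0 2.

(* [s] selects one of the two sheets of the hyperboloid. *)
Definition hyperboloid (R : realType) (s : bool) : set 'rV[R]_3 :=
  [set q | minkowski q q = -1 /\ 0 < (-1) ^+ s * q 0 2].

Definition cosh (R : realType) (x : R) : R := (expR x + expR (- x)) / 2.
Definition sinh (R : realType) (x : R) : R := (expR x - expR (- x)) / 2.
Definition tanh (R : realType) (x : R) : R := sinh x / cosh x.
Definition coth (R : realType) (x : R) : R := cosh x / sinh x.
Definition acosh (R : realType) (x : R) : R := ln (x + Num.sqrt (x ^+ 2 - 1)).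

Definition cot (R : realType) (x : R) : R := cos x / sin x.

(* Hyperbolic central angle, which is the Riemannian distance of a sheet. *)
Definition hyperbolic_dist (R : realType) (p q : 'rV[R]_3) : R :=
  acosh (- minkowski p q).

(* A singularity of a summand is removed from the regular set only when the
   coefficient of that summand is nonzero: since [0 * x = 0] the force function
   is smooth there otherwise. *)

Definition plane_lagrange (R : realType) (m1 m2 f : R) (Z1 Z2 : 'rV[R]_2) :
    mech_system R 2 :=
  {| metric := @dot R 2;
     space := setT;
     regular := [set q | (m1 != 0 -> q <> Z1) /\ (m2 != 0 -> q <> Z2)];
     force := fun q => m1 / euclid_norm (q - Z1) + m2 / euclid_norm (q - Z2)
                       + f * euclid_norm (q - 2^-1 *: (Z1 + Z2)) ^+ 2 |}.

(* cot of the angle to Z_i is singular at Z_i and at its antipode; tan^2 of the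
   angle to the midpoint is singular on the great circle orthogonal to it. *)
Definition sphere_lagrange (R : realType) (m1 m2 f : R) (Z1 Z2 Zm : 'rV[R]_3) :
    mech_system R 3 :=
  {| metric := @dot R 3;
     space := @sphere R;
     regular := [set q | [/\ sphere q,
                             m1 != 0 -> q <> Z1 /\ q <> - Z1,
                             m2 != 0 -> q <> Z2 /\ q <> - Z2 &
                             f != 0 -> dot q Zm != 0]];
     force := fun q => m1 * cot (sphere_dist q Z1) + m2 * cot (sphere_dist q Z2)
                       + f * tan (sphere_dist q Zm) ^+ 2 |}.

Definition hyperbolic_lagrange (R : realType) (s : bool) (m1 m2 f : R)
    (Z1 Z2 Zm : 'rV[R]_3) : mech_system R 3 :=
  {| metric := @minkowski R;
     space := @hyperboloid R s;
     regular := [set q | [/\ hyperboloid s q,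
                             m1 != 0 -> q <> Z1 & m2 != 0 -> q <> Z2]];
     force := fun q => m1 * coth (hyperbolic_dist q Z1)
                       + m2 * coth (hyperbolic_dist q Z2)
                       + f * tanh (hyperbolic_dist q Zm) ^+ 2 |}.

(* Main.v *)
Require Import Defs.
From HB Require Import structures.
From mathcomp Require Import all_boot all_order all_algebra.
From mathcomp Require Import all_classical all_reals all_analysis.
From mathcomp Require Import ring lra.

(** Let [L_i = det (q, q', Z_i)]; in the plane, [L_i] is the angular momentum
    about [Z_i]. For the force of a Lagrange problem the time derivative of
    [L_1 * L_2] is that of a function of the position, so that [L_1 * L_2] plus a
    potential is a first integral. An elastic reflection at a curve preserves
    [L_1 * L_2] as soon as the tangent line bisects the directions to the foci,
    which is the focal property of conics; degenerate conics may lie on the line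
    through the foci, where [L_1 * L_2] is invariant as well. Independence of the
    energy is already seen by varying the velocity alone: the quadratic forms
    [|v|^2] and [L_1 * L_2] are not proportional when [q] is not collinear with
    the foci. *)

Import Order.TTheory GRing.Theory Num.Theory.
Import numFieldNormedType.Exports.

Set Implicit Arguments.
Unset Strict Implicit.
Unset Printing Implicit Defensive.

Local Open Scope classical_set_scope.
Local Open Scope ring_scope.

(** * Smooth functions *)

(** A force directed to one focus has no torque about it, so the derivative of [L_1] involves only
    the second center and the Hooke force, and likewise for [L_2]. What each center then contributes
    to the derivative of [L_1 * L_2] is, up to sign, the derivative of a component of the unit
    vector pointing from that center to the particle, as for the Laplace-Runge-Lenz vector. The
    Hooke force contributes a multiple of [L_1 - L_2], which is tied to the motion across the line
    through the foci. The sphere and the sheets of the hyperboloid are one case: both are pieces of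
    the quadric [<q,q> = eps], with a form that is positive on tangent planes, and the geometry
    becomes polynomial identities modulo [eps * eps = 1]. The plane is treated in parallel, with the
    differences [q - Z_i] in place of the vectors [Z_i]. The delicate point is the wall. An arc may
    pass through a focus, have end points, or lie on a degenerate conic, and all that is known of it
    is that a sum or an absolute difference of distances is constant on a parameter interval. The
    bisection property has to be extracted from this alone. *)

Lemma near_eq_differentiable {R : numFieldType} {V W : normedModType R}
    (f g : V -> W) (x : V) :
  (\near x, f x = g x) -> differentiable f x -> differentiable g x.
Proof.
move=> fg df.
(* The differential of [f] serves for [g] as well, because the remainder is tested only near [x],
   where both functions agree. *)
have gE : g \o shift x = cst (g x) + 'd f x +o_ 0 id.
  have /diff_locally/eqaddoP df0 := df.
  apply/eqaddoP => e e0; move: (df0 e e0).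
  have : \forall h \near (0 : V), f (h + x) = g (h + x).
    by move: fg; rewrite (near_shift 0 x); apply: filterS => y /=; rewrite subr0.
  apply: filterS2 => h fgh; rewrite !fctE /= fgh.
  by rewrite (nbhs_singleton fg).
have dgE := diff_unique (diff_continuous df) gE.
by apply/diff_locallyP; rewrite dgE; split=> //; exact: diff_continuous.
Qed.

Section SmoothNear.
Context {R : realType} {V : normedModType R}.
Implicit Types (O A : set V) (f g : V -> R) (k : nat).

Lemma Ck_subset k (W : normedModType R) O A (f : V -> W) :
  A `<=` O -> Ck k O f -> Ck k A f.
Proof.
elim: k f => [|k IH] f AO /=; first by move=> H x /AO; exact: H.
by move=> [df H]; split=> [x /AO|v]; [exact: df|exact: IH (H v)].
Qed.

Lemma Ck_ext k (W : normedModType R) O (f g : V -> W) : open O ->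
  (forall x, O x -> f x = g x) -> Ck k O f -> Ck k O g.
Proof.
move=> oO; elim: k f g => [|k IH] f g fg /=.
  move=> H x Ox; rewrite /prop_for /continuous_at -(fg _ Ox).
  apply: cvg_trans (H _ Ox); apply: near_eq_cvg.
  by apply: filterS (open_nbhs_nbhs (conj oO Ox)) => y Oy; rewrite fg.
move=> [df H].
have fgn x : O x -> \near x, f x = g x.
  by move=> Ox; apply: filterS (open_nbhs_nbhs (conj oO Ox)) => y; exact: fg.
split=> [x Ox|v]; first exact: near_eq_differentiable (fgn _ Ox) (df _ Ox).
by apply: IH (H v) => x Ox; apply: near_eq_derive; exact: fgn.
Qed.

(** The derivative of a product or a quotient contains the functions themselves, which must be
    available at the order of the induction hypothesis. *)
Lemma CkW k O f : Ck k.+1 O f -> Ck k O f.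
Proof.
elim: k f => [|k IH] f [df H]; first by move=> x /df /differentiable_continuous.
by split=> // v; apply: IH; exact: H.
Qed.

Lemma Ck_cst k O (a : R) : Ck k O (fun=> a).
Proof.
elim: k a => [|k IH] a /=; first by move=> x _; exact: cvg_cst.
split=> [x _|v]; first exact: differentiable_cst.
suff -> : 'D_v (fun _ : V => a) = (fun=> 0) :> (V -> R) by exact: IH.
by apply/funext => x; rewrite derive_cst.
Qed.

Lemma Ck_linear k O (l : {linear V -> R}) : continuous l -> Ck k O l.
Proof.
move=> cl; case: k => [|k]; first by move=> x _; exact: cl.
split=> [x _|v]; first exact: linear_differentiable.
suff -> : 'D_v l = (fun=> l v) :> (V -> R) by exact: Ck_cst.
by apply/funext => x; rewrite deriveE ?diff_lin//; exact: linear_differentiable.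
Qed.

Lemma CkD k O f g : open O -> Ck k O f -> Ck k O g ->
  Ck k O (fun x => f x + g x).
Proof.
move=> oO; elim: k f g => [|k IH] f g.
  by move=> cf cg x Ox; apply: cvgD; [exact: cf|exact: cg].
move=> [df Hf] [dg Hg]; split=> [x Ox|v].
  exact: differentiableD (df _ Ox) (dg _ Ox).
apply: Ck_ext (IH _ _ (Hf v) (Hg v)) => // x Ox /=.
rewrite (@deriveD _ _ _ f g)//; apply: diff_derivable; [exact: df|exact: dg].
Qed.

Lemma CkM k O f g : open O -> Ck k O f -> Ck k O g ->
  Ck k O (fun x => f x * g x).
Proof.
move=> oO; elim: k f g => [|k IH] f g.
  by move=> cf cg x Ox; apply: cvgM; [exact: cf|exact: cg].
move=> fS gS; have [df Hf] := fS; have [dg Hg] := gS; split=> [x Ox|v].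
  exact: differentiableM (df _ Ox) (dg _ Ox).
have H1 := IH _ _ (CkW fS) (Hg v).
have H2 := IH _ _ (CkW gS) (Hf v).
apply: Ck_ext (CkD oO H1 H2) => // x Ox /=.
rewrite (@deriveM _ _ f g)//; apply: diff_derivable; [exact: df|exact: dg].
Qed.

(** By induction on the order: the derivative [- f' / f ^+ 2] again contains [f^-1], at one order
    less. The square root below follows the same pattern. *)
Lemma CkV k O f : open O -> (forall x, O x -> f x != 0) ->
  Ck k O f -> Ck k O (fun x => (f x)^-1).
Proof.
move=> oO f0; elim: k => [|k IH].
  by move=> cf x Ox; apply: cvgV; [exact: f0|exact: cf].
move=> fS; have [df Hf] := fS; split=> [x Ox|v].
  by apply: differentiableV; [exact: df|exact: f0].
have iS := IH (CkW fS).
have H1 := CkM oO (CkM oO (Ck_cst k O (-1)) (CkM oO iS iS)) (Hf v).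
apply: Ck_ext H1 => // x Ox /=.
rewrite deriveV ?f0//; last by apply: diff_derivable; exact: df.
by rewrite /GRing.scale/= expr2 invfM mulN1r.
Qed.

Lemma Ck_sqrt k O f : open O -> (forall x, O x -> 0 < f x) ->
  Ck k O f -> Ck k O (fun x => Num.sqrt (f x)).
Proof.
move=> oO f0; elim: k => [|k IH].
  move=> cf x Ox; apply: (@continuous_comp _ _ _ f Num.sqrt); first exact: cf.
  exact: sqrt_continuous.
move=> fS; have [df Hf] := fS; split=> [x Ox|v].
  apply: (@differentiable_comp _ _ _ _ f Num.sqrt); first exact: df.
  by apply/derivable1_diffP; have [] := is_derive1_sqrt (f0 _ Ox).
have sS := IH (CkW fS).
have s0 x : O x -> 2 * Num.sqrt (f x) != 0.
  by move=> /f0 f0x; rewrite mulf_neq0 ?pnatr_eq0// gt_eqF ?sqrtr_gt0.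
have H1 := CkM oO (CkV oO s0 (CkM oO (Ck_cst k O 2) sS)) (Hf v).
apply: Ck_ext H1 => // x Ox /=.
rewrite [RHS]deriveE; last first.
  apply: (@differentiable_comp _ _ _ _ f Num.sqrt); first exact: df.
  by apply/derivable1_diffP; have [] := is_derive1_sqrt (f0 _ Ox).
have ds : differentiable (Num.sqrt : R -> R) (f x).
  by apply/derivable1_diffP; have [] := is_derive1_sqrt (f0 _ Ox).
rewrite (diff_comp (df _ Ox) ds)/= -(deriveE _ (df _ Ox)).
rewrite deriv1E; last exact/derivable1_diffP.
by rewrite derive1E derive_sqrt ?f0// [LHS]mulrC.
Qed.

Lemma smooth_near_cst A (a : R) : smooth_near A (fun=> a).
Proof. by exists setT; split=> // [|k]; [exact: openT|exact: Ck_cst]. Qed.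

Lemma smooth_near_linear A (l : {linear V -> R}) :
  continuous l -> smooth_near A l.
Proof. by exists setT; split=> // [|k]; [exact: openT|exact: Ck_linear]. Qed.

Lemma smooth_nearD A f g : smooth_near A f -> smooth_near A g ->
  smooth_near A (fun x => f x + g x).
Proof.
move=> [U1 [ op1 A1 S1]] [U2 [ op2 A2 S2]]; exists (U1 `&` U2).
split; [exact: openI | by move=> x Ax; split; [exact: A1 | exact: A2] | move=> k].
have s1 := @subIsetl _ U1 U2; have s2 := @subIsetr _ U1 U2.
by apply: CkD (openI op1 op2) (Ck_subset s1 _) (Ck_subset s2 _).
Qed.

Lemma smooth_nearM A f g : smooth_near A f -> smooth_near A g ->
  smooth_near A (fun x => f x * g x).
Proof.
move=> [U1 [ op1 A1 S1]] [U2 [ op2 A2 S2]]; exists (U1 `&` U2).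
split; [exact: openI | by move=> x Ax; split; [exact: A1 | exact: A2] | move=> k].
have s1 := @subIsetl _ U1 U2; have s2 := @subIsetr _ U1 U2.
by apply: CkM (openI op1 op2) (Ck_subset s1 _) (Ck_subset s2 _).
Qed.

Lemma smooth_nearN A f : smooth_near A f -> smooth_near A (fun x => - f x).
Proof.
move=> sf; suff -> : (fun x => - f x) = (fun x => -1 * f x).
  by apply: smooth_nearM => //; exact: smooth_near_cst.
by apply/funext => x; rewrite mulN1r.
Qed.

(** Inverse and square root need their sign condition on a whole neighbourhood, whereas it is known
    on [A] only; continuity lets the neighbourhood shrink to the preimage of [U]. *)
Lemma smooth_near_shrink A (U : set R) f : open U ->
  (forall x, A x -> U (f x)) -> smooth_near A f ->
  exists O, [/\ open O, A `<=` O, forall x, O x -> U (f x) &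
    forall k, Ck k O f].
Proof.
move=> oU AU [W [ oW AW fW]]; exists [set x | W x /\ U (f x)]; split.
- rewrite openE => x [Ox Ux].
  have nU : nbhs x (f @^-1` U).
    by apply: (fW 0%N x Ox); exact: open_nbhs_nbhs (conj oU Ux).
  apply: filterS2 (open_nbhs_nbhs (conj oW Ox)) nU.
  by move=> y.
- by move=> x Ax; split; [exact: AW|exact: AU].
- by move=> x [].
- by move=> k; apply: Ck_subset (fW k) => x [].
Qed.

Lemma smooth_nearV A f : (forall x, A x -> f x != 0) ->
  smooth_near A f -> smooth_near A (fun x => (f x)^-1).
Proof.
move=> f0 /(smooth_near_shrink (@open_neq _ (0 : R)) f0)[W [ oW AW fW CO]].
by exists W; split=> // k; exact: CkV.
Qed.

Lemma smooth_near_sqrt A f : (forall x, A x -> 0 < f x) ->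
  smooth_near A f -> smooth_near A (fun x => Num.sqrt (f x)).
Proof.
move=> f0 /(smooth_near_shrink (@open_gt _ (0 : R)) f0)[W [ oW AW fW CO]].
by exists W; split=> // k; exact: Ck_sqrt.
Qed.

End SmoothNear.

Section PairCoordinates.
Context {R : realType} {n : nat}.
Notation V := 'rV[R]_n.

Lemma smooth_near_fst (A : set (V * V)) i : smooth_near A (fun p => p.1 0 i).
Proof.
have @l : {linear (V * V)%type -> R}.
  by exists (fun p : (V * V)%type => p.1 0 i); do 2![eexists]; do ?[constructor];
     rewrite ?mxE// => ? *; rewrite ?mxE//; move=> ?; rewrite !mxE.
rewrite (_ : (fun _ => _) = l) //; apply: smooth_near_linear => p.
by apply: (@continuous_comp _ _ _ fst (fun v : V => v 0 i));
  [exact: cvg_fst|exact: coord_continuous].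
Qed.

Lemma smooth_near_snd (A : set (V * V)) i : smooth_near A (fun p => p.2 0 i).
Proof.
have @l : {linear (V * V)%type -> R}.
  by exists (fun p : (V * V)%type => p.2 0 i); do 2![eexists]; do ?[constructor];
     rewrite ?mxE// => ? *; rewrite ?mxE//; move=> ?; rewrite !mxE.
rewrite (_ : (fun _ => _) = l) //; apply: smooth_near_linear => p.
by apply: (@continuous_comp _ _ _ snd (fun v : V => v 0 i));
  [exact: cvg_snd|exact: coord_continuous].
Qed.

End PairCoordinates.

Ltac smooth_rules := repeat first
  [ assumption
  | exact: smooth_near_cst | exact: smooth_near_fst | exact: smooth_near_snd
  | apply: smooth_nearD | apply: smooth_nearM | apply: smooth_nearN ].

(** * Differentiable curves *)

Section Curves.
Context {R : realType}.
Implicit Types (f g : R -> R) (t a b : R) (J : set R).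

Lemma is_derive_rowP n (c : R -> 'rV[R]_n) (t : R) (w : 'rV[R]_n) :
  is_derive t 1 c w <->
  forall i, is_derive t 1 (fun s => c s 0 i) (w 0 i).
Proof.
split=> [[dc cw] i|H].
  have dci := (derivable_mxP c t 1).1 dc 0 i.
  by apply: DeriveDef => //; rewrite -cw derive_mx// mxE.
have dc : derivable c t 1.
  by apply/derivable_mxP => k i; rewrite (ord1 k); have [] := H i.
apply: DeriveDef => //; rewrite derive_mx//; apply/rowP => i; rewrite mxE.
by have [_ ->] := H i.
Qed.

Lemma is_derive_rowE n (c : R -> 'rV[R]_n) (t : R) (w : 'rV[R]_n) i :
  is_derive t 1 c w -> is_derive t 1 (fun s => c s 0 i) (w 0 i).
Proof. by move/is_derive_rowP. Qed.

Lemma is_derive_const t a : is_derive t 1 (fun=> a) 0.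
Proof. exact: is_derive_cst. Qed.

Lemma is_derive_add t f g a b : is_derive t 1 f a -> is_derive t 1 g b ->
  is_derive t 1 (fun s => f s + g s) (a + b).
Proof. by move=> fa gb; exact: is_deriveD. Qed.

Lemma is_derive_opp t f a : is_derive t 1 f a ->
  is_derive t 1 (fun s => - f s) (- a).
Proof. by move=> fa; exact: is_deriveN. Qed.

Lemma is_derive_mul t f g a b : is_derive t 1 f a -> is_derive t 1 g b ->
  is_derive t 1 (fun s => f s * g s) (a * g t + f t * b).
Proof.
move=> fa gb; have := is_deriveM fa gb; congr is_derive.
by rewrite /GRing.scale/= addrC mulrC.
Qed.

Lemma is_derive_inv t f a : f t != 0 -> is_derive t 1 f a ->
  is_derive t 1 (fun s => (f s)^-1) (- a / f t ^+ 2).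
Proof.
move=> f0 fa; have := is_deriveV f0 fa; congr is_derive.
by rewrite /GRing.scale/= mulNr mulrC mulNr.
Qed.

Lemma is_derive_sqrt t f a : 0 < f t -> is_derive t 1 f a ->
  is_derive t 1 (fun s => Num.sqrt (f s)) (a / (2 * Num.sqrt (f t))).
Proof.
move=> f0 fa; have := is_derive1_comp (is_derive1_sqrt f0) fa.
by congr is_derive; rewrite mulrC.
Qed.

Lemma is_derive_comp t f g a b : is_derive (g t) 1 f a -> is_derive t 1 g b ->
  is_derive t 1 (fun s => f (g s)) (a * b).
Proof. by move=> fa gb; exact: is_derive1_comp. Qed.

Lemma is_derive_continuous (W : normedModType R) t (c : R -> W) w :
  is_derive t 1 c w -> {for t, continuous c}.
Proof.
by move=> [/derivable1_diffP dc _]; exact: differentiable_continuous.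
Qed.

Lemma is_derive_affine (W : normedModType R) (p w : W) :
  is_derive (0 : R) 1 (fun s : R => p + s *: w) w.
Proof.
have H : (fun h : R => h^-1 *: (((fun s : R => p + s *: w) \o shift 0) (h *: 1)
    - (p + 0 *: w))) @ 0^' --> w.
  apply: cvg_near_cst; have : \forall h \near (0 : R)^', h != 0.
    exact: nbhs_dnbhs_neq.
  apply: filterS => h h0 /=.
  rewrite addr0 [h *: 1]mulr1 scale0r addr0 addrAC subrr add0r scalerA.
  by rewrite mulVf// scale1r.
by apply: DeriveDef; [apply/cvg_ex; exists w | exact: cvg_lim H].
Qed.

Lemma is_derive_derive1 (W : normedModType R) t (c : R -> W) :
  derivable c t 1 -> is_derive t 1 c (derive1 c t).
Proof. by move=> dc; apply: DeriveDef => //; rewrite derive1E. Qed.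

Lemma near_is_derive_unique (W : normedModType R) t (c1 c2 : R -> W) w1 w2 :
  (\forall s \near t, c1 s = c2 s) ->
  is_derive t 1 c1 w1 -> is_derive t 1 c2 w2 -> w1 = w2.
Proof.
move=> c12 h1 [_ <-].
by have [_ <-] := near_eq_is_derive c12 h1.
Qed.

Lemma is_derive_cast t f a b : is_derive t 1 f a -> a = b -> is_derive t 1 f b.
Proof. by move=> fa <-. Qed.

(** As [f t = 0], the difference quotients are [f s / (s - t)], and they tend to a nonzero limit. *)
Lemma is_derive_neq0_near t f a : is_derive t 1 f a -> f t = 0 -> a != 0 ->
  \forall s \near t^', f s != 0.
Proof.
move=> [df <-] f0 Dn0.
have cvgD : (fun h => h^-1 *: (f (h *: 1 + t) - f t)) @ 0^' --> 'D_1 f t by [].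
have : \forall h \near (0 : R)^', h^-1 *: (f (h *: 1 + t) - f t) != 0.
  apply: (cvgD [set x | x != 0]).
  by apply: open_nbhs_nbhs; split=> //; exact: open_neq.
rewrite !near_withinE => H.
have ct : (fun s : R => s - t) @ t --> (0 : R).
  by rewrite -[X in _ --> X](subrr t); apply: cvgB; [exact: cvg_id | exact: cvg_cst].
have {}H : \forall s \near t, s - t != 0 ->
    (s - t)^-1 *: (f ((s - t) *: 1 + t) - f t) != 0 by exact: (ct _ H).
apply: filterS H => s {}H st.
have : (s - t)^-1 *: (f ((s - t) *: 1 + t) - f t) != 0.
  by apply: H; rewrite subr_eq0.
rewrite f0 subr0 scaler_eq0 negb_or => /andP[_].
by rewrite [_ *: 1]mulr1 subrK.
Qed.

(* The two-sided derivative is determined by its values on one side, so that the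
   lemma also applies at the end points of [J]. *)
Lemma is_derive_constant_on J t f a b : is_interval J -> J° !=set0 -> J t ->
  (forall s, J s -> f s = b) -> is_derive t 1 f a -> a = 0.
Proof.
move=> iJ [r /= Jr] Jt fJ fa; apply/eqP/negPn/negP => a0.
(* The nonempty interior provides a second point of [J], and the segment from [t] to it stays in
   [J]. *)
have [r' Jr' r't] : exists2 r', J r' & r' != t.
  have [<-|rt] := eqVneq r t; last by exists r => //; exact: interior_subset.
  have : \forall s \near r^', J s by apply: cvg_within; exact: Jr.
  have : \forall s \near r^', s != r by exact: nbhs_dnbhs_neq.
  move=> h1 h2; have [s [sr Js]] := filter_ex (filterI h1 h2).
  by exists s.
have fb : is_derive t 1 (fun s => f s - b) a.
  by apply: is_derive_cast (is_derive_add fa (is_derive_const t (- b))) _; rewrite addr0.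
have fb0 : f t - b = 0 by rewrite fJ// subrr.
have := is_derive_neq0_near fb fb0 a0; rewrite near_withinE => -[e /= e0 He].
(* The point [t + l * (r' - t)] lies between [t] and [r'], and at distance at most [e / 2] from
   [t]. *)
pose l := Num.min 2^-1 (e / (2 * `|r' - t|)).
have rt0 : 0 < `|r' - t| by rewrite normr_gt0 subr_eq0.
have l0 : 0 < l by rewrite lt_min invr_gt0 ltr0n divr_gt0// mulr_gt0.
have l1 : l <= 1.
  by rewrite /l ge_min; apply/orP; left; rewrite invf_le1 ?ler1n.
pose h := l * (r' - t).
have Jh : J (h + t).
  have [tr|rt] := leP t r'.
    apply: (iJ t r') => //; apply/andP; split.
      by rewrite lerDr mulr_ge0 ?subr_ge0// ltW.
    by rewrite -lerBrDr ler_piMl// subr_ge0.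
  apply: (iJ r' t) => //; apply/andP; split; last first.
    by rewrite gerDr nmulr_lle0 ?subr_lt0// ltW.
  rewrite -lerBlDr /h -[leLHS]mul1r ler_wnM2r//.
  by rewrite subr_le0 ltW.
have htn : h + t != t.
  by rewrite -subr_eq0 addrK mulf_neq0 ?subr_eq0 ?(gt_eqF l0).
have ball_ht : `|t - (h + t)| < e.
  rewrite opprD addrCA subrr addr0 normrN normrM gtr0_norm//.
  have : l * `|r' - t| <= e / (2 * `|r' - t|) * `|r' - t|.
    by rewrite ler_wpM2r// ge_min lexx orbT.
  move=> /le_lt_trans; apply.
  rewrite invfM mulrA divfK ?gt_eqF//.
  by rewrite ltr_pdivrMr// ltr_pMr// ltr1n.
by have := He _ ball_ht htn; rewrite fJ// subrr eqxx.
Qed.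

Lemma is_derive0_interval J f : is_interval J ->
  (forall t, J t -> is_derive t 1 f 0) ->
  forall s t, J s -> J t -> f s = f t.
Proof.
move=> iJ df; suff H s t : s <= t -> J s -> J t -> f s = f t.
  move=> s t Js Jt; have [st|/ltW ts] := leP s t; first exact: H.
  by apply/esym/H.
move=> st Js Jt.
have Jst x : x \in `[s, t] -> J x.
  by rewrite in_itv/= => sxt; exact: (iJ s t).
have [||c _] := @MVT_segment R f (fun=> 0) s t st; first 1 last.
- apply: continuous_in_subspaceT => x /set_mem xst.
  exact: is_derive_continuous (df _ (Jst _ xst)).
- by rewrite mul0r => /eqP; rewrite subr_eq0 => /eqP.
- move=> x xst; apply/df/Jst; move: xst; rewrite !in_itv/= => /andP[sx xt].
  by rewrite !ltW.
Qed.

Lemma continuous_at_pair (U W : topologicalType) (f1 : R -> U) (f2 : R -> W) t :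
  {for t, continuous f1} -> {for t, continuous f2} ->
  {for t, continuous (fun s => (f1 s, f2 s))}.
Proof. by move=> c1 c2; exact: (cvg_pair c1 c2). Qed.

(** For the density statements: a point of the phase space is reached along a curve that lies in [A]
    at all small nonzero times. *)
Lemma closure_punctured (T : topologicalType) (A : set T) (c : R -> T) :
  {for 0, continuous c} -> (\forall s \near (0 : R)^', A (c s)) ->
  closure A (c 0).
Proof.
move=> cc nA B nB.
have nBc : \forall s \near (0 : R)^', B (c s) by exact/cvg_within/cc.
have : \forall s \near (0 : R)^', A (c s) /\ B (c s) by exact: filterI nA nBc.
by move=> /(@filter_ex _ _ (Proper_dnbhs_numFieldType (0 : R)))[s ABs]; exists (c s).
Qed.

(** After division by a power of [s], the first nonzero coefficient among [d], [b], [a] is the limit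
    at 0. *)
Lemma quadratic_neq0_near a b d : a != 0 ->
  \forall s \near (0 : R)^', a * s ^+ 2 + b * s + d != 0.
Proof.
move=> a0.
have cont (p q r : R) : (fun s : R => p * s ^+ 2 + q * s + r) @ 0^' --> r.
  have : (fun s : R => p * s ^+ 2 + q * s + r) @ 0^' --> p * 0 ^+ 2 + q * 0 + r.
    apply: cvg_within_filter.
    apply: cvgD; last exact: cvg_cst.
    apply: cvgD; apply: cvgM; try exact: cvg_cst; last exact: cvg_id.
    exact: exprn_continuous.
  by rewrite expr0n/= !mulr0 !add0r.
have nz (p q r : R) : r != 0 -> \forall s \near (0 : R)^', p * s ^+ 2 + q * s + r != 0.
  move=> r0; apply: (cont p q r [set x | x != 0]).
  by apply: open_nbhs_nbhs; split=> //; exact: open_neq.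
have s0 : \forall s \near (0 : R)^', s != 0 by exact: nbhs_dnbhs_neq.
have [->|d0] := eqVneq d 0; last exact: nz.
have [->|b0] := eqVneq b 0.
  by apply: filterS s0 => s s0; rewrite mul0r !addr0 mulf_neq0// expf_neq0.
apply: filterS2 s0 (nz 0 a b b0) => s s0 H.
rewrite addr0 expr2 mulrA -mulrDl mulf_neq0//.
by move: H; rewrite mul0r add0r.
Qed.

Lemma is_derive_gt0_near t f a : is_derive t 1 f a -> 0 < f t ->
  \forall s \near t, 0 < f s.
Proof.
move=> fa f0; have : {for t, continuous f} := is_derive_continuous fa.
move=> /(_ [set x | 0 < x]); apply.
by apply: open_nbhs_nbhs; split; [exact: open_gt|].
Qed.

End Curves.

(* [is_derive] is a type class: [notypeclasses] keeps its premises as goals. *)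
Ltac derive_rules := repeat first
  [ eassumption
  | notypeclasses refine (is_derive_const _ _)
  | notypeclasses refine (is_derive_id _ _)
  | notypeclasses refine (is_derive_rowE _ _); eassumption
  | notypeclasses refine (is_derive_add _ _)
  | notypeclasses refine (is_derive_mul _ _)
  | notypeclasses refine (is_derive_opp _) ].

Ltac derive_by tac := notypeclasses refine (is_derive_cast _ _);
  [ derive_rules | tac ].

(** * Reflection at confocal conics *)

Section ConfocalReflection.
Context {R : realType}.

(* At a point of a conic, [A1], [A2] and [B1], [B2] are the components, along the
   tangent and along the normal, of the vectors of lengths [s1], [s2] joining it
   to the foci. Being tangent to a conic reads [A1 / s1 = - A2 / s2] (ellipse) or
   [A1 / s1 = A2 / s2] (hyperbola), and the conclusion is that the tangent
   bisects the directions to the foci. Where [D] vanishes the two vectors are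
   parallel; they then have the wrong relative orientation only if the conic is
   degenerate, and [D] is zero along such a conic. *)
Lemma confocal_reflection (J : set R) (t : R) (d1 d2 k s1 s2 D psi : R -> R)
    (p0 A1 A2 B1 B2 E eta D' : R) :
  is_interval J -> J° !=set0 -> J t ->
  0 < E -> eta != 0 -> (forall x, psi (- x) = psi x) ->
  (forall u, J u -> [/\ 0 <= s1 u, 0 <= s2 u,
    k u ^+ 2 + D u ^+ 2 = (s1 u * s2 u) ^+ 2,
    psi (d1 u + d2 u) = p0 <-> k u = - (s1 u * s2 u) &
    psi (d1 u - d2 u) = p0 <-> k u = s1 u * s2 u]) ->
  (0 < s1 t -> is_derive t 1 d1 (eta * A1 / s1 t)) ->
  (0 < s2 t -> is_derive t 1 d2 (eta * A2 / s2 t)) ->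
  A1 ^+ 2 + B1 ^+ 2 = E * s1 t ^+ 2 ->
  A2 ^+ 2 + B2 ^+ 2 = E * s2 t ^+ 2 ->
  A1 * A2 + B1 * B2 = E * k t ->
  is_derive t 1 D D' -> (D t = 0 -> D' = 0 -> B1 = 0 /\ B2 = 0) ->
  (exists c, (forall u, J u -> d1 u + d2 u = c) \/
             (forall u, J u -> `|d1 u - d2 u| = c)) ->
  A1 * B2 + A2 * B1 = 0.
Proof.
move=> iJ Jne Jt E0 eta0 psiE HJ dd1 dd2 N1 N2 N12 dD degD conic.
have [s1ge0 s2ge0 kD psip psim] := HJ t Jt.
have zero2 (x y : R) : x ^+ 2 + y ^+ 2 = 0 -> x = 0 /\ y = 0.
  by move=> /eqP; rewrite paddr_eq0 ?sqr_ge0// !sqrf_eq0 => /andP[/eqP-> /eqP->].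
(* At a focus one of the two vectors is zero and the conclusion is trivial. *)
have [s1E|s1n] := eqVneq (s1 t) 0.
  have [-> ->] : A1 = 0 /\ B1 = 0 by apply: zero2; rewrite N1 s1E expr0n mulr0.
  by rewrite mul0r mulr0 addr0.
have [s2E|s2n] := eqVneq (s2 t) 0.
  have [-> ->] : A2 = 0 /\ B2 = 0 by apply: zero2; rewrite N2 s2E expr0n mulr0.
  by rewrite mul0r mulr0 addr0.
have s1p : 0 < s1 t by rewrite lt_def s1n.
have s2p : 0 < s2 t by rewrite lt_def s2n.
have {}dd1 := dd1 s1p; have {}dd2 := dd2 s2p.
have En0 : E != 0 by rewrite gt_eqF.
have degenerate_finish : (forall u, J u -> D u = 0) -> A1 * B2 + A2 * B1 = 0.
  move=> DJ; have [-> ->] := degD (DJ _ Jt) (is_derive_constant_on iJ Jne Jt DJ dD).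
  by rewrite !mulr0 addr0.
have D0 u : J u -> k u ^+ 2 = (s1 u * s2 u) ^+ 2 -> D u = 0.
  move=> /HJ[_ _ <- _ _] /eqP.
  by rewrite -subr_eq0 opprD addrA subrr sub0r oppr_eq0 sqrf_eq0 => /eqP.
(* Here the unit vectors to the foci are equal up to the factor [- e], whereas tangency relates
   their tangential components by the factor [e]. Hence these components vanish and the tangent is
   orthogonal to both vectors. *)
have parallel (e : R) : e ^+ 2 = 1 -> A1 * s2 t = e * A2 * s1 t ->
    k t = - e * (s1 t * s2 t) -> A1 * B2 + A2 * B1 = 0.
  move=> e1 tang kE.
  have : (s2 t * A1 + e * s1 t * A2) ^+ 2 + (s2 t * B1 + e * s1 t * B2) ^+ 2 = 0.
    have -> : (s2 t * A1 + e * s1 t * A2) ^+ 2 + (s2 t * B1 + e * s1 t * B2) ^+ 2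
      = s2 t ^+ 2 * (A1 ^+ 2 + B1 ^+ 2) + e ^+ 2 * s1 t ^+ 2 * (A2 ^+ 2 + B2 ^+ 2)
        + 2 * e * s1 t * s2 t * (A1 * A2 + B1 * B2) by ring.
    rewrite N1 N2 N12 kE e1.
    have -> : 2 * e * s1 t * s2 t * (E * (- e * (s1 t * s2 t))) =
      - 2 * e ^+ 2 * E * (s1 t * s2 t) ^+ 2 by ring.
    by rewrite e1; ring.
  move=> /zero2[+ _]; rewrite mulrC tang => eq0.
  have en0 : e != 0.
    by apply/eqP => e0; move/esym/eqP: e1; rewrite e0 expr0n/= oner_eq0.
  have A20 : A2 = 0.
    apply/eqP; have /eqP : 2 * e * s1 t * A2 = 0 by rewrite -eq0; ring.
    by rewrite !mulf_eq0 pnatr_eq0 (negPf en0) (negPf s1n).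
  have A10 : A1 = 0.
    apply/eqP; move/eqP: tang; rewrite A20 mulr0 mul0r mulf_eq0.
    by rewrite (negPf s2n) orbF.
  by rewrite A10 A20 !mul0r addr0.
(* By tangency and equal lengths the normalized components agree up to sign, so [(A1 * B2 + A2 * B1)
   * (A1 * B2 - A2 * B1) = 0]; the second factor has square [E ^+ 2 * D t ^+ 2]. *)
have generic (e : R) : e ^+ 2 = 1 -> A1 * s2 t = e * A2 * s1 t -> D t != 0 ->
    A1 * B2 + A2 * B1 = 0.
  move=> e1 tang Dn0.
  have tang2 : A1 ^+ 2 * s2 t ^+ 2 = A2 ^+ 2 * s1 t ^+ 2.
    by rewrite -exprMn tang !exprMn e1 mul1r.
  have B12 : B1 ^+ 2 * s2 t ^+ 2 = B2 ^+ 2 * s1 t ^+ 2.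
    have -> : B1 ^+ 2 = E * s1 t ^+ 2 - A1 ^+ 2 by rewrite -N1; ring.
    have -> : B2 ^+ 2 = E * s2 t ^+ 2 - A2 ^+ 2 by rewrite -N2; ring.
    by rewrite !mulrBl tang2; ring.
  have AB : (A1 * B2 - A2 * B1) ^+ 2 = E ^+ 2 * D t ^+ 2.
    have -> : D t ^+ 2 = (s1 t * s2 t) ^+ 2 - k t ^+ 2 by rewrite -kD; ring.
    have -> : E ^+ 2 * ((s1 t * s2 t) ^+ 2 - k t ^+ 2) =
      (E * s1 t ^+ 2) * (E * s2 t ^+ 2) - (E * k t) ^+ 2 by ring.
    by rewrite -N1 -N2 -N12; ring.
  have : (s1 t * s2 t) ^+ 2 * ((A1 * B2 + A2 * B1) * (A1 * B2 - A2 * B1)) = 0.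
    have -> : (s1 t * s2 t) ^+ 2 * ((A1 * B2 + A2 * B1) * (A1 * B2 - A2 * B1)) =
      (A1 ^+ 2 * s2 t ^+ 2) * (B2 ^+ 2 * s1 t ^+ 2)
      - (A2 ^+ 2 * s1 t ^+ 2) * (B1 ^+ 2 * s2 t ^+ 2) by ring.
    by rewrite tang2 B12 subrr.
  move/eqP; rewrite !mulf_eq0 (negPf s1n) (negPf s2n)/=.
  case/orP => /eqP// AB0; move/esym/eqP: AB; rewrite AB0 expr0n/= !mulf_eq0.
  by rewrite (negPf En0) (negPf Dn0).
have tangE (e : R) : eta * A1 / s1 t - e * (eta * A2 / s2 t) = 0 ->
    A1 * s2 t = e * A2 * s1 t.
  have -> : eta * A1 / s1 t - e * (eta * A2 / s2 t) =
    eta / (s1 t * s2 t) * (A1 * s2 t - e * A2 * s1 t).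
    by field; rewrite s1n s2n.
  move/eqP; rewrite !mulf_eq0 invr_eq0 mulf_eq0.
  by rewrite (negPf s1n) (negPf s2n) (negPf eta0)/= subr_eq0 => /eqP.
(* [e] is [-1] for an ellipse and [1] for a hyperbola. The value [c = p0] is that of a degenerate
   conic, along which [D] is zero. For any other value, [D t = 0] leaves only the relative
   orientation treated in [parallel]. *)
have alternative (e c : R) : e ^+ 2 = 1 -> A1 * s2 t = e * A2 * s1 t ->
    (forall u, J u -> psi (d1 u - e * d2 u) = c) ->
    (forall u, J u -> psi (d1 u - e * d2 u) = p0 <->
      k u = e * (s1 u * s2 u)) ->
    A1 * B2 + A2 * B1 = 0.
  move=> e1 tang psic psik.
  have [cp|cp] := eqVneq c p0.
    apply: degenerate_finish => u Ju; apply: D0 => //.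
    have -> : k u = e * (s1 u * s2 u) by apply/psik => //; rewrite psic.
    by rewrite exprMn e1 mul1r.
  have [Dt0|] := eqVneq (D t) 0; last exact: (generic e).
  apply: (parallel e) => //.
  have /eqP : (k t - e * (s1 t * s2 t)) * (k t + e * (s1 t * s2 t)) = 0.
    have -> : (k t - e * (s1 t * s2 t)) * (k t + e * (s1 t * s2 t)) =
      k t ^+ 2 - e ^+ 2 * (s1 t * s2 t) ^+ 2 by ring.
    by rewrite -kD Dt0 e1; ring.
  rewrite mulf_eq0 subr_eq0 addr_eq0 => /orP[/eqP/(psik _ Jt)|/eqP->].
    by rewrite psic// => /eqP; rewrite (negPf cp).
  by rewrite mulNr.
have [c [ell|hyp]] := conic.
  apply: (alternative (-1) (psi c)); first by rewrite sqrrN expr1n.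
  - apply: tangE; apply: (is_derive_constant_on iJ Jne Jt ell).
    by rewrite mulN1r opprK; exact: is_derive_add.
  - by move=> u Ju; rewrite mulN1r opprK ell.
  - by move=> u /HJ[_ _ _]; rewrite !mulN1r opprK.
apply: (alternative 1 (psi c)); first by rewrite expr1n.
- apply: tangE; rewrite mul1r.
  have dw := is_derive_add dd1 (is_derive_opp dd2).
  set w' := _ - _ in dw *.
  (* The absolute value is not differentiable at 0. If the difference of distances is 0 at [t], it
     is 0 on all of [J]; otherwise its square, which is constant, is differentiated. *)
  have [w0|wn0] := eqVneq (d1 t - d2 t) 0.
    apply: (is_derive_constant_on iJ Jne Jt (b := 0) _ dw) => u Ju.
    by apply/eqP; rewrite -normr_eq0 hyp// -(hyp t Jt) w0 normr0.
  have w2c u : J u -> (d1 u - d2 u) * (d1 u - d2 u) = c ^+ 2.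
    by move=> Ju; rewrite -expr2 -[LHS]real_normK ?num_real// hyp.
  have /eqP := is_derive_constant_on iJ Jne Jt w2c (is_derive_mul dw dw).
  rewrite [_ * w']mulrC -mulrDr mulf_eq0 -mulr2n mulrn_eq0/= (negPf wn0) orbF.
  by move/eqP.
(* Evenness of [psi] absorbs the absolute value. *)
- move=> u Ju; rewrite mul1r -(hyp u Ju).
  by case: (ger0P (d1 u - d2 u)) => // _; rewrite psiE.
- by move=> u /HJ[_ _ _ _]; rewrite !mul1r.
Qed.

End ConfocalReflection.

(** * Quadrics of constant curvature *)

Section Form.
Context {R : realType}.
Notation V := 'rV[R]_3.
Implicit Types (eps t : R) (u v w q Z : V) (c b : R -> V).

Lemma ord3_ind (P : 'I_3 -> Prop) : P 0 -> P 1 -> P 2 -> forall i, P i.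
Proof.
move=> P0 P1 P2 [[|[|[|//]]] Hi].
- by have -> : Ordinal Hi = 0 by exact: val_inj.
- by have -> : Ordinal Hi = 1 by exact: val_inj.
- by have -> : Ordinal Hi = 2 by exact: val_inj.
Qed.

(** The parameter covers both curved spaces: [eps = 1] is the Euclidean form and [eps = -1] the
    Minkowski form. *)
Definition qdot eps u v : R :=
  u 0 0 * v 0 0 + u 0 1 * v 0 1 + eps * (u 0 2 * v 0 2).

Definition det3 u v w : R :=
  u 0 0 * (v 0 1 * w 0 2 - v 0 2 * w 0 1)
  - u 0 1 * (v 0 0 * w 0 2 - v 0 2 * w 0 0)
  + u 0 2 * (v 0 0 * w 0 1 - v 0 1 * w 0 0).

(* For [eps ^+ 2 = 1], the vector representing [fun u => det3 u v w]. *)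
Definition cross eps v w : V := \row_i
  if i == 0 then v 0 1 * w 0 2 - v 0 2 * w 0 1
  else if i == 1 then v 0 2 * w 0 0 - v 0 0 * w 0 2
  else eps * (v 0 0 * w 0 1 - v 0 1 * w 0 0).

Lemma qdotC eps u v : qdot eps u v = qdot eps v u.
Proof. by rewrite /qdot; ring. Qed.

Lemma qdotDl eps u v w : qdot eps (u + v) w = qdot eps u w + qdot eps v w.
Proof. by rewrite /qdot !mxE; ring. Qed.

Lemma qdotZl eps (a : R) u v : qdot eps (a *: u) v = a * qdot eps u v.
Proof. by rewrite /qdot !mxE; ring. Qed.

Lemma qdotBl eps u v w : qdot eps (u - v) w = qdot eps u w - qdot eps v w.
Proof. by rewrite /qdot !mxE; ring. Qed.

Lemma qdotDr eps u v w : qdot eps u (v + w) = qdot eps u v + qdot eps u w.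
Proof. by rewrite /qdot !mxE; ring. Qed.

Lemma qdotZr eps (a : R) u v : qdot eps u (a *: v) = a * qdot eps u v.
Proof. by rewrite /qdot !mxE; ring. Qed.

Lemma qdotBr eps u v w : qdot eps u (v - w) = qdot eps u v - qdot eps u w.
Proof. by rewrite /qdot !mxE; ring. Qed.

Lemma qdot_cross eps u v w : eps * eps = 1 ->
  qdot eps u (cross eps v w) = det3 u v w.
Proof.
move=> e1; rewrite /qdot /cross /det3 !mxE/=.
rewrite (_ : eps * (u 0 2 * (eps * (v 0 0 * w 0 1 - v 0 1 * w 0 0))) =
  eps * eps * (u 0 2 * (v 0 0 * w 0 1 - v 0 1 * w 0 0))); last by ring.
by rewrite e1; ring.
Qed.

(** Multiplicativity of the determinant: on the right is a Gram determinant, and [eps] is the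
    determinant of the form. *)
Lemma det3_gram eps (a b c d e g : V) :
  eps * (det3 a b c * det3 d e g) =
  qdot eps a d * (qdot eps b e * qdot eps c g - qdot eps b g * qdot eps c e)
  - qdot eps a e * (qdot eps b d * qdot eps c g - qdot eps b g * qdot eps c d)
  + qdot eps a g * (qdot eps b d * qdot eps c e - qdot eps b e * qdot eps c d).
Proof. by rewrite /qdot /det3; ring. Qed.

(** Cramer's linear relation between four vectors of a three-dimensional space, paired with [w]. *)
Lemma det3_dependence eps (a b c d w : V) :
  det3 b c d * qdot eps a w - det3 a c d * qdot eps b w
  + det3 a b d * qdot eps c w - det3 a b c * qdot eps d w = 0.
Proof. by rewrite /qdot /det3; ring. Qed.

Lemma det3_rot u v w : det3 u v w = det3 v w u.
Proof. by rewrite /det3; ring. Qed.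

Lemma det3_same u v : det3 u u v = 0.
Proof. by rewrite /det3; ring. Qed.

Lemma det3_swap u v w : det3 u v w = - det3 u w v.
Proof. by rewrite /det3; ring. Qed.

(** Lagrange's identity for the cross product adapted to the form. *)
Lemma qdot_cross_cross eps u v : eps * eps = 1 ->
  qdot eps (cross eps u v) (cross eps u v) =
  eps * (qdot eps u u * qdot eps v v - qdot eps u v ^+ 2).
Proof.
move=> e1; rewrite qdot_cross// /det3 /cross /qdot !mxE/=.
set c0 := u 0 1 * v 0 2 - u 0 2 * v 0 1; set c1 := u 0 2 * v 0 0 - u 0 0 * v 0 2.
set c2 := u 0 0 * v 0 1 - u 0 1 * v 0 0.
transitivity (eps * eps * (c0 ^+ 2 + c1 ^+ 2) + eps * c2 ^+ 2).
  by rewrite e1 /c0 /c1 /c2; ring.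
by rewrite /c0 /c1 /c2; ring.
Qed.

Lemma is_derive_qdot eps t c b w u :
  is_derive t 1 c w -> is_derive t 1 b u ->
  is_derive t 1 (fun s => qdot eps (c s) (b s))
    (qdot eps w (b t) + qdot eps (c t) u).
Proof.
move=> cw bu; rewrite /qdot; derive_by ltac:(rewrite /=; ring).
Qed.

Lemma is_derive_det3 t c b w u Z :
  is_derive t 1 c w -> is_derive t 1 b u ->
  is_derive t 1 (fun s => det3 (c s) (b s) Z)
    (det3 w (b t) Z + det3 (c t) u Z).
Proof.
move=> cw bu; rewrite /det3; derive_by ltac:(rewrite /=; ring).
Qed.

End Form.

(** A term with zero coefficient is constant even where [g] is singular, in accordance with
    [regular], which removes a singularity only for a nonzero coefficient. *)
Lemma is_derive_scaled {R : realType} (t m a : R) (g : R -> R) :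
  (m != 0 -> is_derive t 1 g a) -> is_derive t 1 (fun s => m * g s) (m * a).
Proof.
have [->|m0 /(_ isT) ga] := eqVneq m 0.
  move=> _; rewrite mul0r (_ : (fun _ => _) = fun=> 0); first exact: is_derive_const.
  by apply/funext => s; rewrite mul0r.
apply: is_derive_cast (is_derive_mul (is_derive_const t m) ga) _.
by rewrite mul0r add0r.
Qed.

Lemma smooth_near_scaled {R : realType} {V : normedModType R} (A : set V) (m : R)
    (g : V -> R) :
  (m != 0 -> smooth_near A g) -> smooth_near A (fun x => m * g x).
Proof.
have [->|m0 /(_ isT) ga] := eqVneq m 0.
  move=> _; rewrite (_ : (fun _ => _) = fun=> 0); first exact: smooth_near_cst.
  by apply/funext => s; rewrite mul0r.
exact: smooth_nearM (smooth_near_cst _ _) ga.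
Qed.

Section Quadric.
Context {R : realType} (eps : R) (M : set 'rV[R]_3).
Notation V := 'rV[R]_3.
Notation "<< u , v >>" := (qdot eps u v).

(* Satisfied by the unit sphere with [eps = 1], by a sheet of the hyperboloid
   with [eps = -1]. *)
Definition quadric_geometry : Prop :=
  [/\ eps * eps = 1,
      forall q, M q -> << q, q >> = eps,
      forall q, M q -> \forall p \near q, << p, p >> = eps -> M p &
      forall q w, M q -> << q, w >> = 0 -> w != 0 -> 0 < << w, w >>].

Hypothesis geoM : quadric_geometry.

Let eps2 : eps * eps = 1. Proof. by have [] := geoM. Qed.
Let Mqdot q : M q -> << q, q >> = eps. Proof. by case: geoM => _ H _ _; exact: H. Qed.
Let Mpos q w : M q -> << q, w >> = 0 -> w != 0 -> 0 < << w, w >>.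
Proof. by case: geoM => _ _ _; exact. Qed.

Lemma curve_at_orthogonal q w c : M q -> curve_at M q w c -> << q, w >> = 0.
Proof.
move=> Mq [c0 Mc cw].
have dform := is_derive_qdot eps cw cw.
have : \forall s \near (0 : R), << c s, c s >> = eps by apply: filterS Mc => s /Mqdot.
move=> /near_is_derive_unique/(_ dform (is_derive_const _ _)).
rewrite c0 (qdotC _ w) -mulr2n => /eqP.
by rewrite mulrn_eq0/= => /eqP.
Qed.

(** Central projection of the line [q + s *: w] onto the quadric: as [w] is orthogonal to [q], the
    form at [q + s *: w] is [eps * r s], and [r] has derivative 0 at 0, so the velocity remains
    [w]. *)
Lemma orthogonal_curve_at q w : M q -> << q, w >> = 0 ->
  exists c, curve_at M q w c.
Proof.
move=> Mq qw.
pose r (s : R) := 1 + s * s * (eps * << w, w >>).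
pose c (s : R) := (Num.sqrt (r s))^-1 *: (q + s *: w).
have r0 : r 0 = 1 by rewrite /r !mul0r addr0.
have dr : is_derive (0 : R) 1 r 0.
  by rewrite /r; derive_by ltac:(rewrite /=; ring).
have c0 : c 0 = q by rewrite /c r0 sqrtr1 invr1 scale1r scale0r addr0.
have dc : is_derive (0 : R) 1 c w.
  apply/is_derive_rowP => i; rewrite /c.
  under eq_fun do rewrite !mxE.
  have ds := is_derive_sqrt (f := r) (t := 0) _ dr.
  rewrite r0 in ds; have {}ds := ds ltr01.
  have s0 : Num.sqrt (r 0) != 0 by rewrite r0 sqrtr1 oner_eq0.
  have dv := is_derive_inv (f := fun s => Num.sqrt (r s)) s0 ds.
  by derive_by ltac:(rewrite /= r0 sqrtr1; field).
exists c; split=> //.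
have rpos : \forall s \near (0 : R), 0 < r s.
  have : {for 0, continuous r} := is_derive_continuous dr.
  move=> /(_ [set x | 0 < x]); apply.
  by apply: open_nbhs_nbhs; split; [exact: open_gt|rewrite /= r0].
have nM : \forall s \near (0 : R), << c s, c s >> = eps -> M (c s).
  have [_ _ + _] := geoM => /(_ q Mq); rewrite -c0.
  by move=> H; exact: (is_derive_continuous dc H).
apply: filterS2 rpos nM => s rs; apply.
rewrite /c qdotZl qdotZr qdotDl !qdotDr !qdotZl !qdotZr (qdotC _ w q) qw Mqdot//.
have := sqr_sqrtr (ltW rs); have : Num.sqrt (r s) != 0 by rewrite gt_eqF ?sqrtr_gt0.
set y := Num.sqrt _ => y0 y2.
have -> : y^-1 * (y^-1 * (eps + s * 0 + (s * 0 + s * (s * << w, w >>)))) =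
  (eps + s * s * << w, w >>) / y ^+ 2 by field.
have -> : eps + s * s * << w, w >> = eps * y ^+ 2.
  rewrite y2 /r; transitivity (eps + eps * eps * (s * s * << w, w >>)).
    by rewrite eps2; ring.
  by ring.
by field.
Qed.

Lemma tangent_orthogonal q w : M q -> tangent M q w <-> << q, w >> = 0.
Proof.
move=> Mq; split=> [[c]|]; first exact: curve_at_orthogonal.
exact: orthogonal_curve_at.
Qed.

(* [sin ^+ 2] of the distance for [eps = 1], [sinh ^+ 2] for [eps = -1]. *)
Definition sinsq q Z : R := eps * (1 - << q, Z >> ^+ 2).

(** The vector is the component of [Z] tangent to the quadric at [q]. Positivity of the form on the
    tangent plane then gives the sign of [sinsq]. *)
Lemma sinsq_rejection q Z : M q -> M Z ->
  << q, Z - (eps * << q, Z >>) *: q >> = 0 /\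
  << Z - (eps * << q, Z >>) *: q, Z - (eps * << q, Z >>) *: q >> = sinsq q Z.
Proof.
move=> Mq MZ; rewrite !(qdotBl, qdotBr, qdotZl, qdotZr) (qdotC _ Z q) !Mqdot// /sinsq.
move: << q, Z >> => x; split.
  by transitivity (x * (1 - eps * eps)); [ring | rewrite eps2; ring].
transitivity (eps - 2 * (eps * x ^+ 2) + eps * eps * (eps * x ^+ 2)); first by ring.
by rewrite eps2; ring.
Qed.

Lemma sinsq_gt0 q Z : M q -> M Z -> Z <> (eps * << q, Z >>) *: q -> 0 < sinsq q Z.
Proof.
move=> Mq MZ nqZ; have [ort <-] := sinsq_rejection Mq MZ.
by apply: (Mpos Mq ort); rewrite subr_eq0; exact/eqP.
Qed.

Lemma sinsq_ge0 q Z : M q -> M Z -> 0 <= sinsq q Z.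
Proof.
move=> Mq MZ; have [ort eq2] := sinsq_rejection Mq MZ.
have [Z0|Zn0] := eqVneq (Z - (eps * << q, Z >>) *: q) 0.
  by rewrite -eq2 Z0 /qdot !mxE !mul0r !addr0 mulr0.
by rewrite -eq2; exact/ltW/(Mpos Mq ort).
Qed.

End Quadric.

(** * The Lagrange problem on a quadric *)

Section CurvedLagrange.
Context {R : realType} (eps : R) (M : set 'rV[R]_3) (S : mech_system R 3)
  (m1 m2 f kap : R) (Z1 Z2 Zm : 'rV[R]_3).
Notation V := 'rV[R]_3.
Notation "<< u , v >>" := (qdot eps u v).

Definition sn (q Z : V) : R := Num.sqrt (sinsq eps q Z).

(** Both curved problems in terms of the form alone. On the sphere [<q,Z>] is the cosine of the
    distance, on the hyperboloid [- <q,Z>] is its hyperbolic cosine; this accounts for the factors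
    [eps]. *)
Definition curved_lagrange : Prop :=
  [/\ metric S = qdot eps, Defs.space S = M,
      forall q, regular S q <->
        [/\ M q, m1 != 0 -> 0 < sinsq eps q Z1, m2 != 0 -> 0 < sinsq eps q Z2 &
            f != 0 -> << q, Zm >> != 0] &
      forall q, M q -> force S q =
        m1 * (eps * << q, Z1 >> / sn q Z1) +
        (m2 * (eps * << q, Z2 >> / sn q Z2) +
         f * (eps * (1 - << q, Zm >> ^+ 2) / << q, Zm >> ^+ 2))].

Hypotheses (geoM : quadric_geometry eps M) (lagS : curved_lagrange).
Hypotheses (MZ1 : M Z1) (MZ2 : M Z2) (MZm : M Zm).
Hypotheses (Zsum : Z1 + Z2 = kap *: Zm) (kap0 : kap != 0).
Hypothesis Zind : 0 < sinsq eps Z1 Z2.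

Let eps2 : eps * eps = 1. Proof. by have [] := geoM. Qed.
Let Mqdot q : M q -> << q, q >> = eps. Proof. by case: geoM => _ H _ _; exact: H. Qed.
Let Mpos q w : M q -> << q, w >> = 0 -> w != 0 -> 0 < << w, w >>.
Proof. by case: geoM => _ _ _; exact. Qed.

Lemma sn_sqr (q Z : V) : 0 < sinsq eps q Z -> sn q Z != 0 /\
  sn q Z ^+ 2 = eps * (1 - << q, Z >> ^+ 2).
Proof. by move=> h; rewrite sqr_sqrtr ?ltW// gt_eqF// sqrtr_gt0. Qed.

Lemma is_derive_qdotl (t : R) (c : R -> V) (w : V) (Z : V) : is_derive t 1 c w ->
  is_derive t 1 (fun s => << c s, Z >>) << w, Z >>.
Proof.
move=> cw; rewrite /qdot; derive_by ltac:(rewrite /=; ring).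
Qed.

Lemma is_derive_sn (t : R) (c : R -> V) (w : V) (Z : V) : is_derive t 1 c w ->
  0 < sinsq eps (c t) Z ->
  is_derive t 1 (fun s => sn (c s) Z) (- (eps * << c t, Z >> * << w, Z >>) / sn (c t) Z).
Proof.
move=> cw h; have [s0 _] := sn_sqr h.
have dx := is_derive_qdotl Z cw.
have d2 : is_derive t 1 (fun s => sinsq eps (c s) Z)
    (- (2 * eps * << c t, Z >> * << w, Z >>)).
  rewrite /sinsq; under eq_fun do rewrite expr2.
  by derive_by ltac:(rewrite /=; ring).
apply: is_derive_cast (is_derive_sqrt (f := fun s => sinsq eps (c s) Z) h d2) _.
by rewrite -/(sn _ _); field.
Qed.

Lemma is_derive_kepler (t : R) (c : R -> V) (w : V) (Z : V) : is_derive t 1 c w ->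
  0 < sinsq eps (c t) Z ->
  is_derive t 1 (fun s => eps * << c s, Z >> / sn (c s) Z)
    (<< w, Z >> / sn (c t) Z ^+ 3).
Proof.
move=> cw h; have [s0 s2] := sn_sqr h.
have dx := is_derive_qdotl Z cw.
have dv := is_derive_inv (f := fun s => sn (c s) Z) s0 (is_derive_sn cw h).
notypeclasses refine (is_derive_cast _ _); first by derive_rules.
rewrite /=; move: s0 s2; set s := sn _ _ => s0 s2.
transitivity (<< w, Z >> * (eps * s ^+ 2 + eps * eps * << c t, Z >> ^+ 2) / s ^+ 3).
  by field.
by rewrite s2 mulrA eps2; congr (_ / _); ring.
Qed.

Lemma is_derive_hooke (t : R) (c : R -> V) (w : V) (Z : V) : is_derive t 1 c w ->
  << c t, Z >> != 0 ->
  is_derive t 1 (fun s => eps * (1 - << c s, Z >> ^+ 2) / << c s, Z >> ^+ 2)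
    (- 2 * eps * << w, Z >> / << c t, Z >> ^+ 3).
Proof.
move=> cw x0; have dx := is_derive_qdotl Z cw.
have dv := is_derive_inv (f := fun s => << c s, Z >>) x0 dx.
rewrite (_ : (fun _ => _) = (fun s => eps * (1 - << c s, Z >> * << c s, Z >>)
    * (<< c s, Z >>^-1 * << c s, Z >>^-1))); last first.
  by apply/funext => s; rewrite !expr2 invfM.
by derive_by ltac:(rewrite /=; field).
Qed.

(** An ambient vector that is not projected to the tangent plane: it is only paired with tangent
    vectors, and as a combination of [Z1], [Z2], [Zm] it is easy to insert into determinants. *)
Definition gradient (q : V) : V :=
  (m1 / sn q Z1 ^+ 3) *: Z1 + (m2 / sn q Z2 ^+ 3) *: Z2
  + (f * (- 2 * eps / << q, Zm >> ^+ 3)) *: Zm.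

Let regular_space q : regular S q -> M q.
Proof. by case: lagS => _ _ rE _ /rE[]. Qed.

Lemma is_derive_force q w c : regular S q -> curve_at M q w c ->
  is_derive (0 : R) 1 (force S \o c) << gradient q, w >>.
Proof.
case: lagS => _ _ rE fE /rE[Mq r1 r2 rm] [c0 Mc cw].
rewrite -c0 in r1 r2 rm.
have K1 := is_derive_scaled (fun h => is_derive_kepler cw (r1 h)).
have K2 := is_derive_scaled (fun h => is_derive_kepler cw (r2 h)).
have HK := is_derive_scaled (fun h => is_derive_hooke cw (rm h)).
have := is_derive_add K1 (is_derive_add K2 HK).
move=> /(is_derive_cast (b := << gradient q, w >>)) H.
apply: near_eq_is_derive (H _); first by apply: filterS Mc => s Ms; rewrite /= fE.
rewrite c0 /gradient !qdotDl !qdotZl !(qdotC _ w) !mulrA; ring.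
Qed.

(** The vector [a] given by [solution] is eliminated by differentiating the force function in two
    ways along a curve with velocity [w]. *)
Lemma acceleration (J : set R) q t w : open J -> solution S J q -> J t ->
  << q t, w >> = 0 ->
  << derive1 (derive1 q) t, w >> = << gradient (q t), w >>.
Proof.
move=> oJ sol Jt qw; have [rq _ _ [a [[_ cov] [_ grad]]]] := sol t Jt.
have [mE sE _ _] := lagS; rewrite mE sE in cov grad.
have [c cc] := orthogonal_curve_at geoM (regular_space rq) qw.
have tw : tangent M (q t) w by exists c.
have [_ <-] := is_derive_force rq cc; have [_ ->] := grad w c cc.
by have /eqP := cov w tw; rewrite qdotBl subr_eq0 => /eqP.
Qed.

(** Each Kepler term pairs the unit vector at its center pointing to [p.1] with the other focus. The
    quotient [det3 p.1 Z1 Z2 / << p.1, Zm >>] is, up to a constant factor, the signed distance to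
    the line through the foci after central projection to the tangent plane at [Zm]. *)
Definition integral (p : V * V) : R :=
  det3 p.1 p.2 Z1 * det3 p.1 p.2 Z2 +
  (m1 * ((<< p.1, Z2 >> - eps * << Z1, Z2 >> * << p.1, Z1 >>) / sn p.1 Z1) +
   (m2 * ((<< p.1, Z1 >> - eps * << Z2, Z1 >> * << p.1, Z2 >>) / sn p.1 Z2) +
    f * (2 / kap ^+ 2 * (det3 p.1 Z1 Z2 / << p.1, Zm >> * (det3 p.1 Z1 Z2 / << p.1, Zm >>))))).

(** The unit vector at [Z] pointing to the particle turns at the rate
    [det3 (c t) v Z / sn (c t) Z ^+ 2], up to orientation. The product of determinants is evaluated
    by [det3_gram], where [v] orthogonal to [c t] simplifies the result. *)
Lemma is_derive_kepler_integral (t : R) (c : R -> V) (v : V) (Z Z' : V) : M (c t) -> M Z ->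
  << c t, v >> = 0 -> is_derive t 1 c v -> 0 < sinsq eps (c t) Z ->
  is_derive t 1 (fun s => (<< c s, Z' >> - eps * << Z, Z' >> * << c s, Z >>) / sn (c s) Z)
    (- (det3 (c t) v Z * det3 (c t) Z Z') / sn (c t) Z ^+ 3).
Proof.
move=> Mq MZ qv cv h; have [s0 s2] := sn_sqr h.
have dx := is_derive_qdotl Z cv; have dx' := is_derive_qdotl Z' cv.
have dv := is_derive_inv (f := fun s => sn (c s) Z) s0 (is_derive_sn cv h).
notypeclasses refine (is_derive_cast _ _); first by derive_rules.
rewrite /=; move: s0 s2; set s := sn _ _ => s0 s2.
have := det3_gram eps (c t) v Z (c t) Z Z'.
rewrite !Mqdot// (qdotC _ v (c t)) qv (qdotC _ Z (c t)).
set L := det3 _ _ _ * _ => LE.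
have L2 : L = eps * (eps * L) by rewrite mulrA eps2 mul1r.
rewrite {}LE in L2; move: L2; set x := << c t, Z >>; set x' := << c t, Z' >>.
set y := << v, Z >>; set y' := << v, Z' >>; set z := << Z, Z' >> => ->.
transitivity (((y' - eps * z * y) * s ^+ 2 + eps * x * y * (x' - eps * z * x)) / s ^+ 3).
  by field.
rewrite s2 -/x; congr (_ / _).
transitivity (eps * y' * (1 - x ^+ 2) - (eps * eps) * z * y + eps * x * x' * y).
  by ring.
transitivity (- (eps * eps * (y * z)) + (eps * eps) * eps * y' - eps * x ^+ 2 * y'
  + eps * x * x' * y); first by rewrite eps2; ring.
by ring.
Qed.

(** Pair [Z1 + Z2 = kap *: Zm] with the foci. For the midpoint of the foci the second identity makes
    [kap] twice the cosine, or hyperbolic cosine, of half their distance. *)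
Lemma qdot_focus : << Z1, Zm >> = << Z2, Zm >> /\ 2 * << Z1, Zm >> = kap * eps.
Proof.
have e1 : << Z1, Z1 + Z2 >> = << Z2, Z1 + Z2 >>.
  by rewrite !qdotDr !Mqdot// (qdotC _ Z2 Z1) addrC.
have e2 : << Z1, Zm >> = << Z2, Zm >>.
  by move: e1; rewrite Zsum !qdotZr => /(mulfI kap0).
split=> //; have : << Z1 + Z2, Zm >> = kap * eps by rewrite Zsum qdotZl Mqdot.
by rewrite qdotDl -e2 => <-; ring.
Qed.

Lemma is_derive_hooke_integral (t : R) (c : R -> V) (v : V) :
  is_derive t 1 c v -> << c t, Zm >> != 0 ->
  is_derive t 1 (fun s => 2 / kap ^+ 2 *
    (det3 (c s) Z1 Z2 / << c s, Zm >> * (det3 (c s) Z1 Z2 / << c s, Zm >>)))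
    (2 * eps * det3 (c t) Z1 Z2 * (det3 (c t) v Z1 - det3 (c t) v Z2)
     / (kap * << c t, Zm >> ^+ 3)).
Proof.
move=> cv x0; have dx := is_derive_qdotl Zm cv.
have dv := is_derive_inv (f := fun s => << c s, Zm >>) x0 dx.
have dD : is_derive t 1 (fun s => det3 (c s) Z1 Z2) (det3 v Z1 Z2).
  by rewrite /det3; derive_by ltac:(rewrite /=; ring).
notypeclasses refine (is_derive_cast _ _); first by derive_rules.
(* The quotient rule produces [D' * x - D * y]. The relation between [c t], [v], [Z1], [Z2], paired
   with [Zm], turns it into a multiple of [L1 - L2], since both foci have the same product with
   [Zm]. *)
rewrite /=; have := det3_dependence eps (c t) v Z1 Z2 Zm.
have [<- Z1m] := qdot_focus.
have {}Z1m : << Z1, Zm >> = kap * eps / 2.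
  by apply/eqP; rewrite eq_sym -subr_eq0 -Z1m; apply/eqP; field.
rewrite Z1m.
set D := det3 (c t) Z1 Z2; set D' := det3 v Z1 Z2; set x := << c t, Zm >> in x0 *.
set y := << v, Zm >>; set L1 := det3 (c t) v Z1; set L2 := det3 (c t) v Z2 => dep.
have {}dep : D' * x - D * y = kap * eps / 2 * (L1 - L2).
  by apply/eqP; rewrite -subr_eq0 -dep; apply/eqP; ring.
transitivity (2 / kap ^+ 2 * (2 * D * (D' * x - D * y) / x ^+ 3)).
  by field; rewrite kap0 x0.
by rewrite dep; field; rewrite x0 kap0.
Qed.

(** The torques about the foci. Writing [Zm] as a multiple of [Z1 + Z2] makes both of them multiples
    of [det3 q Z1 Z2]. *)
Lemma det3_gradient (q : V) :
  det3 (gradient q) Z1 q = - det3 q Z1 Z2 *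
    (m2 / sn q Z2 ^+ 3 + f * (- 2 * eps / << q, Zm >> ^+ 3) / kap) /\
  det3 (gradient q) Z2 q = det3 q Z1 Z2 *
    (m1 / sn q Z1 ^+ 3 + f * (- 2 * eps / << q, Zm >> ^+ 3) / kap).
Proof.
have ZmE : Zm = kap^-1 *: (Z1 + Z2) by rewrite Zsum scalerA mulVf// scale1r.
rewrite /gradient; move: (m1 / _) (m2 / _) (f * _) => a1 a2 a3.
by rewrite ZmE /det3 !mxE; split; ring.
Qed.

Lemma integral_constant : forall (J : set R) (q : R -> V), open J ->
  is_interval J -> solution S J q -> forall s t, J s -> J t ->
  integral (q s, derive1 q s) = integral (q t, derive1 q t).
Proof.
move=> J q oJ iJ sol; apply: (is_derive0_interval
  (f := fun s => integral (q s, derive1 q s))) => // t Jt.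
have [rq dq ddq _] := sol t Jt; have [_ sE rE _] := lagS.
have Mq := regular_space rq.
have /rE[_ r1 r2 rm] := rq.
have qv : is_derive t 1 q (derive1 q t) by exact: is_derive_derive1.
have va : is_derive t 1 (derive1 q) (derive1 (derive1 q) t).
  exact: is_derive_derive1.
have qdotv : << q t, derive1 q t >> = 0.
  have dqq := is_derive_qdot eps qv qv.
  have : \forall s \near t, << q s, q s >> = eps.
    apply: filterS (open_nbhs_nbhs (conj oJ Jt)) => s Js.
    by have [rs _ _ _] := sol s Js; rewrite Mqdot//; exact: regular_space.
  move=> /near_is_derive_unique/(_ dqq (is_derive_const _ _)).
  rewrite (qdotC _ (derive1 q t)) -mulr2n => /eqP.
  by rewrite mulrn_eq0/= => /eqP.
(* [det3 q q'' Z] is the pairing of [q''] with [cross eps Z q], a vector tangent at [q], so the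
   equation of motion applies to it. *)
have dL Z : is_derive t 1 (fun s => det3 (q s) (derive1 q s) Z)
    (det3 (gradient (q t)) Z (q t)).
  apply: is_derive_cast (is_derive_det3 Z qv va) _.
  have h0 : << q t, cross eps Z (q t) >> = 0 by rewrite qdot_cross// /det3; ring.
  have := acceleration oJ sol Jt h0; rewrite !qdot_cross// => <-.
  by rewrite det3_same add0r det3_rot.
have [g1 g2] := det3_gradient (q t).
have LL := is_derive_mul (dL Z1) (dL Z2).
have K1 := is_derive_scaled (fun h => is_derive_kepler_integral Z2 Mq MZ1 qdotv qv (r1 h)).
have K2 := is_derive_scaled (fun h => is_derive_kepler_integral Z1 Mq MZ2 qdotv qv (r2 h)).
have HK := is_derive_scaled (fun h => is_derive_hooke_integral qv (rm h)).
apply: is_derive_cast (is_derive_add LL (is_derive_add K1 (is_derive_add K2 HK))) _.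
rewrite g1 g2 /=; rewrite (det3_swap _ Z2 Z1).
rewrite [(kap * _)^-1]invfM; move: (_ ^+ 3)^-1 (_ ^+ 3)^-1 (_ ^+ 3)^-1 => i1 i2 i3.
by ring.
Qed.

Lemma smooth_integral : smooth_near (phase S) integral.
Proof.
have [_ sE rE _] := lagS.
have phaseE p : phase S p -> [/\ M p.1, m1 != 0 -> 0 < sinsq eps p.1 Z1,
    m2 != 0 -> 0 < sinsq eps p.1 Z2 & f != 0 -> << p.1, Zm >> != 0].
  by move=> [/rE].
have sq Z : smooth_near (phase S) (fun p => << p.1, Z >>).
  by rewrite /qdot; smooth_rules.
have sD : smooth_near (phase S) (fun p => det3 p.1 Z1 Z2).
  by rewrite /det3; smooth_rules.
have sL Z : smooth_near (phase S) (fun p => det3 p.1 p.2 Z).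
  by rewrite /det3; smooth_rules.
have ss Z : (forall p, phase S p -> 0 < sinsq eps p.1 Z) ->
    smooth_near (phase S) (fun p => (sn p.1 Z)^-1).
  move=> h; apply: smooth_nearV => [p /h /sn_sqr[]//|].
  apply: smooth_near_sqrt => //; rewrite /sinsq; under eq_fun do rewrite expr2.
  by smooth_rules; exact: sq.
rewrite /integral; apply: smooth_nearD; first exact: smooth_nearM.
apply: smooth_nearD; last apply: smooth_nearD; apply: smooth_near_scaled => h.
- apply: smooth_nearM; last by apply: ss => p /phaseE[_ /(_ h)].
  by smooth_rules; exact: sq.
- apply: smooth_nearM; last by apply: ss => p /phaseE[_ _ /(_ h)].
  by smooth_rules; exact: sq.
- have sx : smooth_near (phase S) (fun p => << p.1, Zm >>^-1).
    by apply: smooth_nearV (sq Zm) => p /phaseE[_ _ _ /(_ h)].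
  by smooth_rules.
Qed.

Lemma first_integral_integral : first_integral S integral.
Proof. by split; [exact: smooth_integral | exact: integral_constant]. Qed.

(** Pythagoras in the tangent plane at [q]: up to the length of [e], the two terms are the
    components, along [e] and normal to it, of the projection of [Z], whose squared length is
    [sinsq]. *)
Lemma gram_square (q e Z : V) : M q -> M Z -> << q, e >> = 0 ->
  << e, Z >> ^+ 2 + det3 q e Z ^+ 2 = << e, e >> * sn q Z ^+ 2.
Proof.
move=> Mq MZ qe; rewrite sqr_sqrtr ?(sinsq_ge0 geoM)// /sinsq.
have := det3_gram eps q e Z q e Z.
rewrite !(Mqdot Mq, Mqdot MZ) (qdotC _ e q) qe (qdotC _ Z q) (qdotC _ Z e) -expr2 => h.
have -> : det3 q e Z ^+ 2 = eps * (eps * det3 q e Z ^+ 2) by rewrite mulrA eps2 mul1r.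
rewrite h; set x := << q, Z >>; set A := << e, Z >>; set E := << e, e >>.
transitivity ((1 - eps * eps) * A ^+ 2 + eps * E * (eps * eps - x ^+ 2)); first by ring.
by rewrite eps2; ring.
Qed.

(** * Reflections at confocal conics on a quadric *)

Section Reflection.
Context (dist : V -> V -> R) (psi : R -> R).

(* [psi] is [cos] on the sphere and [cosh] on the hyperboloid. *)
Definition distance_function : Prop :=
  [/\ forall x, psi (- x) = psi x,
      forall q, M q -> psi (dist q Z1 + dist q Z2) =
        << q, Z1 >> * << q, Z2 >> - eps * (sn q Z1 * sn q Z2),
      forall q, M q -> psi (dist q Z1 - dist q Z2) =
        << q, Z1 >> * << q, Z2 >> + eps * (sn q Z1 * sn q Z2) &
      forall Z t (c : R -> V) w, M Z -> M (c t) -> is_derive t 1 c w ->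
        0 < sinsq eps (c t) Z ->
        is_derive t 1 (fun s => dist (c s) Z) (- << w, Z >> / sn (c t) Z)].

Hypothesis distP : distance_function.

(** [confocal_reflection] applied to the projections of the foci to the tangent plane at [q], whose
    product is [k]. The critical value [eps * << Z1, Z2 >>] is [psi] of the focal distance, and
    [eta = -1] because these projections point towards the foci, where the distance decreases. *)
Lemma mirror_condition (B : wall R 3) (i : wall_piece B) t :
  confocal_combination M dist Z1 Z2 B -> wall_dom i t ->
  let q := wall_map i t in let e := derive1 (wall_map i) t in
  [/\ M q, << q, e >> = 0, 0 < << e, e >> &
   << e, Z1 >> * det3 q e Z2 + << e, Z2 >> * det3 q e Z1 = 0].
Proof.
move=> [[arcB _] conB] Jt.
have [iJ Jne [W [_ JW smW]] JM] := arcB i.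
have [Mq en0] := JM t Jt.
have ce : is_derive t 1 (wall_map i) (derive1 (wall_map i) t).
  apply: is_derive_derive1; apply: diff_derivable.
  by have [dW _] := smW 1%N; exact/dW/JW.
set c := wall_map i in Mq en0 ce *; set e := derive1 c t in en0 ce *.
have qe : << c t, e >> = 0.
  (* The smooth extension of the arc may leave [M] outside the parameter interval, so tangency of
     [e] is deduced from the values on the interval alone. *)
  have cM s : wall_dom i s -> << c s, c s >> = eps by move=> /JM[/Mqdot].
  have := is_derive_constant_on iJ Jne Jt cM (is_derive_qdot eps ce ce).
  rewrite (qdotC _ e) -mulr2n => /eqP.
  by rewrite mulrn_eq0/= => /eqP.
have E0 := Mpos Mq qe en0.
split=> //=.
have [psiE psiD psiB dd] := distP.
have dD : is_derive t 1 (fun s => det3 (c s) Z1 Z2) (det3 e Z1 Z2).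
  by rewrite /det3; derive_by ltac:(rewrite /=; ring).
have gramE (x y : R) : eps * x = y -> x = eps * y.
  by move=> <-; rewrite mulrA eps2 mul1r.
have aux (P w z : R) : P - eps * w = eps * z <-> z - eps * P = - w.
  split=> h.
    have -> : z = eps * (P - eps * w) by rewrite h mulrA eps2 mul1r.
    by transitivity (- (eps * eps * w)); [ring | rewrite eps2; ring].
  have -> : w = eps * P - z by rewrite -[LHS]opprK -h opprB.
  by transitivity (P - eps * eps * P + eps * z); [ring | rewrite eps2; ring].
apply: (@confocal_reflection R (wall_dom i) t
  (fun s => dist (c s) Z1) (fun s => dist (c s) Z2)
  (fun s => << Z1, Z2 >> - eps * (<< c s, Z1 >> * << c s, Z2 >>))
  (fun s => sn (c s) Z1) (fun s => sn (c s) Z2) (fun s => det3 (c s) Z1 Z2)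
  psi (eps * << Z1, Z2 >>) << e, Z1 >> << e, Z2 >> (det3 (c t) e Z1)
  (det3 (c t) e Z2) << e, e >> (-1) (det3 e Z1 Z2) iJ Jne Jt E0 _ psiE
  _ _ _ _ _ _ dD).
- by rewrite oppr_eq0 oner_eq0.
- move=> u /JM[Mu _].
  have s1 := sqr_sqrtr (sinsq_ge0 geoM Mu MZ1).
  have s2 := sqr_sqrtr (sinsq_ge0 geoM Mu MZ2).
  split; [exact: sqrtr_ge0|exact: sqrtr_ge0| | |].
  + rewrite exprMn s1 s2 /sinsq.
    have := det3_gram eps (c u) Z1 Z2 (c u) Z1 Z2.
    rewrite !Mqdot// (qdotC _ Z1 (c u)) (qdotC _ Z2 (c u)) (qdotC _ Z2 Z1).
    rewrite -expr2 => /gramE ->.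
    set x := << c u, Z1 >>; set y := << c u, Z2 >>; set z := << Z1, Z2 >>.
    transitivity (z ^+ 2 - 2 * eps * x * y * z + eps * eps * (x * y) ^+ 2
      + eps * eps * (eps * eps - z ^+ 2 - x ^+ 2 - y ^+ 2) + 2 * eps * x * y * z).
      by ring.
    by transitivity (eps * eps * ((1 - x ^+ 2) * (1 - y ^+ 2)));
      [rewrite eps2; ring | ring].
  + by rewrite psiD//; exact: aux.
  + rewrite psiB//; have := aux (<< c u, Z1 >> * << c u, Z2 >>)
      (- (sn (c u) Z1 * sn (c u) Z2)) << Z1, Z2 >>.
    by rewrite mulrN !opprK.
- by rewrite {1}/sn sqrtr_gt0 => h; have := dd Z1 t c e MZ1 Mq ce h; rewrite mulN1r.
- by rewrite {1}/sn sqrtr_gt0 => h; have := dd Z2 t c e MZ2 Mq ce h; rewrite mulN1r.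
- exact: gram_square.
- exact: gram_square.
- rewrite (gramE _ _ (det3_gram eps (c t) e Z1 (c t) e Z2)).
  rewrite (Mqdot Mq) (qdotC _ e (c t)) qe (qdotC _ Z1 (c t)) (qdotC _ Z1 e).
  set x := << c t, Z1 >>; set y := << c t, Z2 >>.
  transitivity ((1 - eps * eps) * (<< e, Z1 >> * << e, Z2 >>)
    + (eps * eps * << Z1, Z2 >> - eps * (x * y)) * << e, e >>); first by ring.
  by rewrite eps2; ring.
(* Paired with [Z1] and with [Z2], the relation between [c t], [e], [Z1], [Z2] becomes a linear
   system for the two normal components, whose determinant is [sinsq eps Z1 Z2] up to sign. *)
- move=> D0 D'0.
  have dep w := det3_dependence eps (c t) e Z1 Z2 w.
  have := dep Z1; have := dep Z2; rewrite D0 D'0 (Mqdot MZ1) (Mqdot MZ2) (qdotC _ Z2 Z1).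
  set a := det3 (c t) e Z1; set b := det3 (c t) e Z2 => h2 h1.
  have bE : b = eps * << Z1, Z2 >> * a.
    have h1' : eps * b = << Z1, Z2 >> * a.
      by apply/eqP; rewrite -subr_eq0; apply/eqP; rewrite -h1; ring.
    by rewrite (gramE _ _ h1') mulrA.
  suff a0 : a = 0 by rewrite bE a0 mulr0.
  have /eqP : sinsq eps Z1 Z2 * a = 0.
    by rewrite -[RHS]oppr0 -[in RHS]h2 bE /sinsq; ring.
  by rewrite mulf_eq0 gt_eqF// => /eqP.
- have [C [cc conC] JC] := conB i; exists cc.
  by case: conC => CE; [left | right] => u /JC; rewrite CE => -[].
Qed.

(** Only the determinants depend on the velocity. In components along [e] and normal to it they are
    [(B_i * a - d * A_i) / E], and a reflection changes the sign of [d]; their product thus changes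
    by a multiple of [A1 * B2 + A2 * B1]. *)
Lemma reflection_integral (B : wall R 3) :
  confocal_combination M dist Z1 Z2 B -> reflection_invariant S B integral.
Proof.
move=> conB i t v Jt _; have := mirror_condition conB Jt.
set q := wall_map i t; set e := derive1 (wall_map i) t => -[Mq qe E0 mir].
have [mE _ _ _] := lagS.
rewrite /integral /=; congr (_ + _); rewrite mE /reflection /tangential.
set E := << e, e >> in E0 *; set w := _ - _.
have wE Z : det3 q w Z = 2 * (<< v, e >> / E) * det3 q e Z - det3 q v Z.
  by rewrite /w /det3 !mxE; ring.
have E_neq0 : E != 0 by rewrite gt_eqF.
(* The relation between [q], [e], [v], [Z], paired with [e], decomposes [v] along [e] and its
   normal. *)
have dep Z : det3 q v Z * E = det3 q e Z * << v, e >> - det3 q e v * << e, Z >>.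
  apply/eqP; rewrite -subr_eq0 -oppr0 -[X in _ == - X](det3_dependence eps q e v Z e).
  by rewrite qe -/E (qdotC _ Z e); apply/eqP; ring.
have L Z : det3 q v Z = (det3 q e Z * << v, e >> - det3 q e v * << e, Z >>) / E.
  by rewrite -dep mulfK.
rewrite !wE !L; move: mir; set A1 := << e, Z1 >>; set A2 := << e, Z2 >>.
set B1 := det3 q e Z1; set B2 := det3 q e Z2; set a := << v, e >>; set d := det3 q e v.
move=> mir; apply/eqP; rewrite -subr_eq0.
have -> : (2 * (a / E) * B1 - (B1 * a - d * A1) / E) * (2 * (a / E) * B2 - (B2 * a - d * A2) / E)
  - (B1 * a - d * A1) / E * ((B2 * a - d * A2) / E) =
  2 * a * d / E ^+ 2 * (A1 * B2 + A2 * B1) by field.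
by rewrite mir mulr0.
Qed.

End Reflection.

(* Derivative of the velocity-dependent part of the integral when [v] rotates. *)
Definition rotation_derivative (q v : V) : R :=
  det3 q (cross eps q v) Z1 * det3 q v Z2 + det3 q v Z1 * det3 q (cross eps q v) Z2.

Lemma phaseP q v : phase S (q, v) <-> regular S q /\ << q, v >> = 0.
Proof.
have [_ sE _ _] := lagS; rewrite /phase /= sE.
by split=> -[rq tv]; split=> //; apply/(tangent_orthogonal geoM v (regular_space rq)).
Qed.

(** The position is fixed, so only the parts quadratic in the velocity contribute to the
    derivatives. *)
Lemma vertical_curve q v w : phase S (q, v) -> << q, w >> = 0 ->
  let c s := (q, v + s *: w) in
  [/\ curve_at (phase S) (q, v) (0, w) c,
    is_derive (0 : R) 1 (energy S \o c) << v, w >> &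
    is_derive (0 : R) 1 (integral \o c)
      (det3 q w Z1 * det3 q v Z2 + det3 q v Z1 * det3 q w Z2)].
Proof.
move=> /phaseP[rq qv] qw c; have [mE _ _ _] := lagS.
have dw := is_derive_affine v w; have dq := is_derive_cst q (0 : R) 1.
have c0 : v + 0 *: w = v by rewrite scale0r addr0.
split.
- split; first by rewrite /c c0.
    by exists 1 => //= s _; apply/phaseP; rewrite qdotDr qdotZr qv qw mulr0 addr0.
  rewrite (_ : c = fun s => (q, v) + s *: (0, w)); first exact: is_derive_affine.
  by apply/funext => s; congr pair; rewrite /= scaler0 addr0.
- rewrite /comp /energy /c mE /=.
  have dE := is_derive_qdot eps dw dw; rewrite c0 (qdotC _ w) in dE.
  notypeclasses refine (is_derive_cast _ _); first by derive_rules.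
  by rewrite /=; field.
- rewrite /comp /integral /c /=.
  have d1 := is_derive_det3 Z1 dq dw; have d2 := is_derive_det3 Z2 dq dw.
  notypeclasses refine (is_derive_cast _ _); first by derive_rules.
  by rewrite /= c0 /det3 !mxE; ring.
Qed.

(** Two variations of the velocity: the rotation [cross eps q v] preserves the energy, the scaling
    [v] changes it at the rate [<v,v>]. The minor is therefore [- <v,v>] times the rotation
    derivative. *)
Lemma independent_at_rotation q v : phase S (q, v) ->
  rotation_derivative q v != 0 -> independent_at S (energy S) integral (q, v).
Proof.
move=> pqv rot; have /phaseP[rq qv] := pqv.
have Mq := regular_space rq.
have qn : << q, cross eps q v >> = 0 by rewrite qdot_cross// /det3; ring.
have [c1 E1 G1] := vertical_curve pqv qn.
have [c2 E2 G2] := vertical_curve pqv qv.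
do 8!eexists; split; [exact: c1 | exact: c2 | split; [exact: E1 | exact: G1]
  | split; [exact: E2 | exact: G2] | ].
have -> : << v, cross eps q v >> = 0 by rewrite qdot_cross// /det3; ring.
rewrite mul0r sub0r oppr_eq0 mulf_neq0//; apply: lt0r_neq0; apply: (Mpos Mq qv).
apply: contra_neq rot => ->.
by rewrite /rotation_derivative /det3 !mxE; ring.
Qed.

Lemma det3_foci_neq0 q : M q -> det3 q Z1 Z2 != 0 -> sinsq eps q Z1 != 0.
Proof.
move=> Mq; apply: contra_neq => s0.
have := det3_gram eps q Z1 Z2 q Z1 Z2; move: s0.
rewrite /sinsq (Mqdot Mq) (Mqdot MZ1) (Mqdot MZ2) (qdotC _ Z1 q) (qdotC _ Z2 q) (qdotC _ Z2 Z1).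
set D := det3 q Z1 Z2; set x := << q, Z1 >>; set y := << q, Z2 >>; set z := << Z1, Z2 >>.
move=> s0 DE.
have x2 : x ^+ 2 = 1.
  have : eps * (eps * (1 - x ^+ 2)) = 0 by rewrite s0 mulr0.
  by rewrite mulrA eps2 mul1r => /eqP; rewrite subr_eq0 eq_sym => /eqP.
(* With [x ^+ 2 = 1] the Gram formula expresses [D ^+ 2] as minus a square. *)
have : D ^+ 2 + (z - eps * x * y) ^+ 2 = 0.
  have -> : D ^+ 2 = eps * (eps * (D * D)) by rewrite mulrA eps2 mul1r.
  rewrite DE; transitivity (eps * eps * (eps * eps - z ^+ 2 - x ^+ 2 - y ^+ 2)
    + z ^+ 2 + eps * eps * (x ^+ 2 * y ^+ 2)); first by ring.
  by rewrite eps2 x2; ring.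
by move/eqP; rewrite paddr_eq0 ?sqr_ge0// sqrf_eq0 => /andP[/eqP].
Qed.

Lemma rotation_derivative_quadratic q v w s :
  rotation_derivative q (v + s *: w) =
  rotation_derivative q w * s ^+ 2
  + (det3 q (cross eps q v) Z1 * det3 q w Z2 + det3 q (cross eps q w) Z1 * det3 q v Z2
     + det3 q v Z1 * det3 q (cross eps q w) Z2
     + det3 q w Z1 * det3 q (cross eps q v) Z2) * s + rotation_derivative q v.
Proof.
have lin Z : det3 q (v + s *: w) Z = det3 q v Z + s * det3 q w Z.
  by rewrite /det3 !mxE; ring.
have linc Z : det3 q (cross eps q (v + s *: w)) Z =
    det3 q (cross eps q v) Z + s * det3 q (cross eps q w) Z.
  by rewrite /det3 /cross !mxE/=; ring.
by rewrite /rotation_derivative !lin !linc; ring.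
Qed.

Lemma independent_dense_at q v : phase S (q, v) -> det3 q Z1 Z2 != 0 ->
  closure [set p | phase S p /\ independent_at S (energy S) integral p] (q, v).
Proof.
move=> pqv D0; have /phaseP[rq qv] := pqv; have Mq := regular_space rq.
(* The velocity [w] points along the line through [q] and [Z1], so its determinant with [Z1]
   vanishes and its rotation derivative is [- sinsq eps q Z1 * det3 q Z1 Z2]. This is the leading
   coefficient of a quadratic polynomial in [s]. *)
pose w := Z1 - (eps * << q, Z1 >>) *: q.
have [qw _] := sinsq_rejection geoM Mq MZ1.
have w0 : rotation_derivative q w != 0.
  have L1 : det3 q w Z1 = 0 by rewrite /w /det3 !mxE; ring.
  have L2 : det3 q w Z2 = det3 q Z1 Z2 by rewrite /w /det3 !mxE; ring.
  have N1 : det3 q (cross eps q w) Z1 = - sinsq eps q Z1.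
    have -> : cross eps q w = cross eps q Z1.
      by apply/rowP => j; rewrite /w /cross !mxE; case: ifP => _; [|case: ifP => _]; ring.
    have -> : det3 q (cross eps q Z1) Z1 = - det3 (cross eps q Z1) q Z1.
      by rewrite /det3; ring.
    rewrite -(qdot_cross _ _ _ eps2) qdot_cross_cross// (Mqdot Mq) (Mqdot MZ1).
    by rewrite eps2.
  rewrite /rotation_derivative L1 L2 N1 mul0r addr0 mulf_neq0//.
  by rewrite oppr_eq0 det3_foci_neq0.
have := @closure_punctured R _ [set p | phase S p /\ independent_at S (energy S) integral p]
  (fun s => (q, v + s *: w)).
rewrite scale0r addr0; apply.
  have [[_ _ cw] _ _] := vertical_curve pqv qw.
  exact: is_derive_continuous cw.
have rotE := rotation_derivative_quadratic q v w.
set b := _ + _ + _ + _ in rotE.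
have := quadratic_neq0_near b (rotation_derivative q v) w0; apply: filterS => s rs /=.
have ps : phase S (q, v + s *: w).
  by apply/phaseP; rewrite qdotDr qdotZr qv qw mulr0 addr0.
by split=> //; apply: independent_at_rotation => //; rewrite rotE.
Qed.

Lemma regular_near q (c : R -> V) w : regular S q -> curve_at M q w c ->
  \forall s \near (0 : R), regular S (c s).
Proof.
have [_ _ rE _] := lagS; move=> /rE[Mq r1 r2 rm] [c0 Mc cw].
have nx Z : 0 < sinsq eps q Z -> \forall s \near (0 : R), 0 < sinsq eps (c s) Z.
  rewrite -c0 => h; have dx := is_derive_qdotl Z cw.
  have d2 : is_derive (0 : R) 1 (fun s => sinsq eps (c s) Z)
      (- (2 * eps * << c 0, Z >> * << w, Z >>)).
    rewrite /sinsq; under eq_fun do rewrite expr2.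
    by derive_by ltac:(rewrite /=; ring).
  exact: is_derive_gt0_near d2 h.
have scaled (m : R) (P : R -> Prop) : (m != 0 -> \forall s \near (0 : R), P s) ->
    \forall s \near (0 : R), m != 0 -> P s.
  have [_ _|_ /(_ isT)] := eqVneq m 0; first by exists 1 => //=.
  by apply: filterS => s Ps _.
have n1 := scaled m1 _ (fun h => nx Z1 (r1 h)).
have n2 := scaled m2 _ (fun h => nx Z2 (r2 h)).
have nm : \forall s \near (0 : R), f != 0 -> << c s, Zm >> != 0.
  apply: scaled => /rm; rewrite -c0 => h.
  have dx := is_derive_qdotl Zm cw.
  have := is_derive_gt0_near (is_derive_mul dx dx); rewrite -expr2 exprn_even_gt0//.
  by move=> /(_ h); apply: filterS => s; rewrite -expr2 exprn_even_gt0.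
by near=> s; apply/rE; split; near: s.
Unshelve. all: by end_near. Qed.

(** Leave the geodesic through the foci in its normal direction [cross eps Z1 Z2]: there
    [det3 q Z1 Z2] has derivative [sinsq eps Z1 Z2], which is nonzero. *)
Lemma noncollinear_dense q v : phase S (q, v) ->
  closure [set p | phase S p /\ det3 p.1 Z1 Z2 != 0] (q, v).
Proof.
move=> pqv; have [D0|D0] := eqVneq (det3 q Z1 Z2) 0; last exact: subset_closure.
have /phaseP[rq qv] := pqv; have Mq := regular_space rq.
have qN : << q, cross eps Z1 Z2 >> = 0 by rewrite qdot_cross.
have [c cc] := orthogonal_curve_at geoM Mq qN; have [c0 Mc cN] := cc.
have dx := is_derive_qdotl v cN.
(* The velocity is projected to the tangent plane at the moving point. *)
pose b s := (c s, v - (eps * << c s, v >>) *: c s).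
have b0 : b 0 = (q, v) by rewrite /b c0 qv mulr0 scale0r subr0.
rewrite -b0; apply: closure_punctured.
  have cc0 : {for (0 : R), continuous c} := is_derive_continuous cN.
  have cx : {for (0 : R), continuous (fun s => << c s, v >>)} := is_derive_continuous dx.
  apply: continuous_at_pair; first exact: cc0.
  apply: cvgB; first exact: cvg_cst.
  by apply: cvgZ; [apply: cvgM; [exact: cvg_cst | exact: cx] | exact: cc0].
have dD : is_derive (0 : R) 1 (fun s => det3 (c s) Z1 Z2) (det3 (cross eps Z1 Z2) Z1 Z2).
  by rewrite /det3; derive_by ltac:(rewrite /=; ring).
have DN : det3 (cross eps Z1 Z2) Z1 Z2 != 0.
  rewrite -(qdot_cross _ _ _ eps2) qdot_cross_cross// (Mqdot MZ1) (Mqdot MZ2) eps2.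
  by rewrite gt_eqF.
have D00 : det3 (c 0) Z1 Z2 = 0 by rewrite c0.
have nD := is_derive_neq0_near dD D00 DN.
have nr : \forall s \near (0 : R)^', regular S (c s).
  exact: (cvg_within _ (regular_near rq cc)).
apply: filterS2 nr nD => s rs Ds; split=> //; apply/phaseP; split=> //.
by rewrite qdotBr qdotZr (Mqdot (regular_space rs)) mulrAC eps2 mul1r subrr.
Qed.

Lemma independent_integral : functionally_independent S (energy S) integral.
Proof.
move=> [q v] pqv.
have sub : [set p | phase S p /\ det3 p.1 Z1 Z2 != 0] `<=`
    closure [set p | phase S p /\ independent_at S (energy S) integral p].
  by move=> [q' v'] [pqv' D0]; exact: independent_dense_at.
have := closureS sub (noncollinear_dense pqv).
by rewrite -(closure_id _).1//; exact: closed_closure.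
Qed.

Lemma curved_integrable (dist : V -> V -> R) (psi : R -> R) (B : wall R 3) :
  distance_function dist psi -> confocal_combination M dist Z1 Z2 B ->
  integrable_billiard S B.
Proof.
move=> distP conB; exists integral; split.
- exact: first_integral_integral.
- exact: reflection_integral distP _ conB.
- exact: independent_integral.
Qed.

End CurvedLagrange.

(** * The sphere *)

Section QuadricPoints.
Context {R : realType} (eps : R) (M : set 'rV[R]_3).
Hypothesis geoM : quadric_geometry eps M.
Notation V := 'rV[R]_3.
Notation "<< u , v >>" := (qdot eps u v).

Lemma sinsq_gt0P (q Z : V) : M q -> M Z ->
  0 < sinsq eps q Z <-> q <> Z /\ q <> - Z.
Proof.
have [eps2 Mqdot _ _] := geoM; move=> Mq MZ; split=> [h|[nZ nZ']].
  split=> qE; move: h; rewrite /sinsq qE.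
    by rewrite Mqdot// expr2 eps2 subrr mulr0 ltxx.
  by rewrite -(scaleN1r Z) qdotZl Mqdot// mulN1r sqrrN expr2 eps2 subrr mulr0 ltxx.
apply: (sinsq_gt0 geoM Mq MZ) => ZE.
have : (eps * << q, Z >>) ^+ 2 = 1.
  have := congr1 (fun u => << u, u >>) ZE.
  rewrite /= qdotZl qdotZr !Mqdot//; set a := eps * _ => h.
  transitivity (eps * (a * (a * eps))); last by rewrite -h.
  by transitivity (eps * eps * a ^+ 2); [rewrite eps2 mul1r | ring].
move/eqP; rewrite sqrf_eq1 => /orP[]/eqP e1; move: ZE; rewrite e1.
  by rewrite scale1r => /esym.
by rewrite scaleN1r => ZE; case: nZ'; rewrite ZE opprK.
Qed.

(** The difference of the two sides is tangent at [Zm] and has square zero, so it vanishes by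
    positivity. The last hypothesis is the double angle formula for half the focal distance. *)
Lemma midpoint_sum (Z1 Z2 Zm : V) : M Z1 -> M Z2 -> M Zm ->
  << Zm, Z1 >> = << Zm, Z2 >> -> 2 * << Zm, Z1 >> ^+ 2 = 1 + eps * << Z1, Z2 >> ->
  Z1 + Z2 = (2 * eps * << Zm, Z1 >>) *: Zm.
Proof.
have [eps2 Mqdot _ Mpos] := geoM; move=> M1 M2 Mm; set y := << Zm, Z1 >> => y2 yz.
apply/eqP; rewrite eq_sym -subr_eq0; apply/negP => /negP wn0.
have := Mpos _ _ Mm _ wn0; rewrite !(qdotBl, qdotBr, qdotDl, qdotDr, qdotZl, qdotZr).
rewrite !Mqdot// (qdotC _ Z1 Zm) (qdotC _ Z2 Zm) (qdotC _ Z2 Z1) -y2 -/y.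
have -> : << Z1, Z2 >> = eps * (2 * y ^+ 2 - 1).
  by rewrite yz addrAC subrr add0r mulrA eps2 mul1r.
move=> /(_ _); set t1 := (X in 0 < X); have -> : t1 = 0.
  rewrite /t1; transitivity (4 * (eps * eps) * eps * y ^+ 2 - 4 * eps * y ^+ 2); first by ring.
  by rewrite eps2; ring.
rewrite ltxx => H; suff : false by []; apply: H.
by transitivity (2 * (eps * eps - 1) * y); [ring | rewrite eps2; ring].
Qed.

End QuadricPoints.

Section Sphere.
Context {R : realType}.
Notation V := 'rV[R]_3.

Lemma dot_qdot : @dot R 3 = qdot 1.
Proof.
apply/funext => u; apply/funext => v; rewrite /dot !big_ord_recl big_ord0 /qdot.
rewrite (_ : lift ord0 ord0 = 1); last exact: val_inj.
rewrite (_ : lift ord0 (lift ord0 ord0) = 2); last exact: val_inj.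
by rewrite mul1r addr0 addrA.
Qed.

Lemma sphere_geometry : quadric_geometry 1 (@Defs.sphere R).
Proof.
split; first by rewrite mulr1.
- by move=> q; rewrite /Defs.sphere /= dot_qdot.
- by move=> q _; apply: (@filterE _ (nbhs q)) => p; rewrite /Defs.sphere /= dot_qdot.
- move=> _ w _ _ w0; have sq : qdot 1 w w = w 0 0 ^+ 2 + w 0 1 ^+ 2 + w 0 2 ^+ 2.
    by rewrite /qdot; ring.
  rewrite lt_def sq !addr_ge0 ?sqr_ge0// andbT; apply: contra_neq w0 => /eqP.
  rewrite !paddr_eq0 ?addr_ge0 ?sqr_ge0// !sqrf_eq0 => /andP[/andP[/eqP w0 /eqP w1] /eqP w2].
  by apply/rowP; apply: ord3_ind; rewrite mxE.
Qed.

Lemma sphere_range (q Z : V) : Defs.sphere q -> Defs.sphere Z ->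
  -1 <= qdot 1 q Z <= 1.
Proof.
move=> Mq MZ; have := sinsq_ge0 sphere_geometry Mq MZ.
by rewrite /sinsq mul1r subr_ge0 -ler_norml -real_normK ?num_real// expr_le1.
Qed.

Lemma sn_sphere (q Z : V) : sn 1 q Z = Num.sqrt (1 - qdot 1 q Z ^+ 2).
Proof. by rewrite /sn /sinsq mul1r. Qed.

Lemma sphere_curved_lagrange m1 m2 f (Z1 Z2 Zm : V) :
  Defs.sphere Z1 -> Defs.sphere Z2 -> Defs.sphere Zm ->
  curved_lagrange 1 (@Defs.sphere R) (sphere_lagrange m1 m2 f Z1 Z2 Zm) m1 m2 f Z1 Z2 Zm.
Proof.
move=> M1 M2 Mm; split=> //.
- exact: dot_qdot.
- move=> q; rewrite /= dot_qdot; split=> -[Mq r1 r2 rm]; split=> //.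
  + by move=> /r1; rewrite (sinsq_gt0P sphere_geometry).
  + by move=> /r2; rewrite (sinsq_gt0P sphere_geometry).
  + by move=> /r1; rewrite (sinsq_gt0P sphere_geometry).
  + by move=> /r2; rewrite (sinsq_gt0P sphere_geometry).
- move=> q Mq /=; rewrite /cot /tan /sphere_dist dot_qdot !sn_sphere.
  have rg (Z : V) : Defs.sphere Z -> -1 <= qdot 1 q Z <= 1 by exact: sphere_range.
  have ck (Z : V) : Defs.sphere Z -> cos (acos (qdot 1 q Z)) = qdot 1 q Z.
    by move=> MZ; rewrite acosK// in_itv/= rg.
  rewrite !sin_acos ?rg// !ck// !mul1r -addrA.
  rewrite exprMn exprVn sqr_sqrtr//.
  by have := sinsq_ge0 sphere_geometry Mq Mm; rewrite /sinsq mul1r.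
Qed.

Lemma sphere_distance (Z1 Z2 : V) : Defs.sphere Z1 -> Defs.sphere Z2 ->
  distance_function 1 (@Defs.sphere R) Z1 Z2 (@sphere_dist R) (@cos R).
Proof.
move=> M1 M2.
have rg (q Z : V) : Defs.sphere q -> Defs.sphere Z -> -1 <= qdot 1 q Z <= 1.
  exact: sphere_range.
have ck (q Z : V) : Defs.sphere q -> Defs.sphere Z -> cos (acos (qdot 1 q Z)) = qdot 1 q Z.
  by move=> Mq MZ; rewrite acosK// in_itv/= rg.
rewrite /sphere_dist dot_qdot; split.
- exact: cosN.
- by move=> q Mq; rewrite cosD !ck// !sin_acos ?rg// !sn_sphere mul1r.
- by move=> q Mq; rewrite cosB !ck// !sin_acos ?rg// !sn_sphere mul1r.
- move=> Z t c w MZ Mc cw; rewrite /sinsq mul1r => h.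
  have x1 : -1 < qdot 1 (c t) Z < 1.
    by move: h; rewrite subr_gt0 -ltr_norml -real_normK ?num_real// expr_lt1.
  have := is_derive_comp (g := fun s => qdot 1 (c s) Z) (is_derive1_acos x1) (is_derive_qdotl 1 Z cw).
  by rewrite sn_sphere mulNr mulrC mulNr.
Qed.

Lemma sphere_midpoint (Z1 Z2 Zm : V) : Defs.sphere Z1 -> Defs.sphere Z2 ->
  midpoint (@Defs.sphere R) (@sphere_dist R) Z1 Z2 Zm ->
  Z1 + Z2 = (2 * 1 * qdot 1 Zm Z1) *: Zm.
Proof.
move=> M1 M2 [Mm d1 d2].
have ck (q Z : V) : Defs.sphere q -> Defs.sphere Z -> cos (acos (qdot 1 q Z)) = qdot 1 q Z.
  by move=> Mq MZ; rewrite acosK// in_itv/= sphere_range.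
rewrite /sphere_dist dot_qdot in d1 d2.
apply: (midpoint_sum sphere_geometry) => //.
  by rewrite -(ck Zm Z1)// -(ck Zm Z2)// d1 d2.
rewrite -(ck Zm Z1)// d1 mul1r -[in RHS](ck Z1 Z2)//.
set a := acos _; rewrite [in RHS](splitr a) cosD -!expr2 sin2cos2; ring.
Qed.

Theorem sphere_integrable (m1 m2 f : R) (Z1 Z2 Zm : V) (B : wall R 3) :
  Defs.sphere Z1 -> Defs.sphere Z2 -> Z2 <> Z1 -> Z2 <> - Z1 ->
  midpoint (@Defs.sphere R) (@sphere_dist R) Z1 Z2 Zm ->
  confocal_combination (@Defs.sphere R) (@sphere_dist R) Z1 Z2 B ->
  integrable_billiard (sphere_lagrange m1 m2 f Z1 Z2 Zm) B.
Proof.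
move=> M1 M2 n12 n12' mid conB; have [Mm _ _] := mid.
have Zsum := sphere_midpoint M1 M2 mid.
(* A zero factor would make the foci antipodal. *)
have k0 : 2 * 1 * qdot 1 Zm Z1 != 0.
  apply/eqP => k0; move: Zsum; rewrite k0 scale0r => /eqP.
  by rewrite addrC addr_eq0 => /eqP.
have Zind : 0 < sinsq 1 Z1 Z2.
  apply/(sinsq_gt0P sphere_geometry M1 M2); split=> [|ZE]; first by move/esym.
  by apply: n12'; rewrite ZE opprK.
exact: (curved_integrable sphere_geometry (sphere_curved_lagrange m1 m2 f M1 M2 Mm)
  M1 M2 Mm Zsum k0 Zind (sphere_distance M1 M2)).
Qed.

End Sphere.

(** * The hyperbolic plane *)

Section HyperbolicFunctions.
Context {R : realType}.
Implicit Types x y : R.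

Lemma sqr_cosh x : Defs.cosh x ^+ 2 = 1 + Defs.sinh x ^+ 2.
Proof.
have e1 : expR x * expR (- x) = 1 by rewrite expRN mulfV// gt_eqF// expR_gt0.
rewrite /Defs.cosh /Defs.sinh; transitivity
  (1 + ((expR x - expR (- x)) / 2) ^+ 2 + (expR x * expR (- x) - 1)); first by field.
by rewrite e1 subrr addr0.
Qed.

Lemma coshN x : Defs.cosh (- x) = Defs.cosh x.
Proof. by rewrite /Defs.cosh opprK addrC. Qed.

Lemma sinhN x : Defs.sinh (- x) = - Defs.sinh x.
Proof. by rewrite /Defs.sinh opprK; field. Qed.

Lemma coshD x y : Defs.cosh (x + y) =
  Defs.cosh x * Defs.cosh y + Defs.sinh x * Defs.sinh y.
Proof. by rewrite /Defs.cosh /Defs.sinh opprD !expRD; field. Qed.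

Lemma acosh_arg_gt0 y : 1 <= y -> 0 < y + Num.sqrt (y ^+ 2 - 1).
Proof. by move=> y1; rewrite ltr_wpDr ?sqrtr_ge0// (lt_le_trans ltr01). Qed.

(** The product of [y + sqrt (y ^+ 2 - 1)] and [y - sqrt (y ^+ 2 - 1)] is 1. *)
Lemma expR_acosh y : 1 <= y -> expR (Defs.acosh y) = y + Num.sqrt (y ^+ 2 - 1) /\
  expR (- Defs.acosh y) = y - Num.sqrt (y ^+ 2 - 1).
Proof.
move=> y1; have p := acosh_arg_gt0 y1.
have e1 : expR (Defs.acosh y) = y + Num.sqrt (y ^+ 2 - 1) by rewrite lnK ?posrE.
split=> //; rewrite expRN e1; apply: (mulfI (lt0r_neq0 p)).
rewrite mulfV ?gt_eqF// [RHS]mulrC -subr_sqr sqr_sqrtr ?subr_ge0 ?exprn_ege1//.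
by rewrite opprB addrC subrK.
Qed.

Lemma acoshK y : 1 <= y -> Defs.cosh (Defs.acosh y) = y.
Proof. by move=> /expR_acosh[e1 e2]; rewrite /Defs.cosh e1 e2; field. Qed.

Lemma sinh_acosh y : 1 <= y -> Defs.sinh (Defs.acosh y) = Num.sqrt (y ^+ 2 - 1).
Proof. by move=> /expR_acosh[e1 e2]; rewrite /Defs.sinh e1 e2; field. Qed.

Lemma is_derive_acosh (t : R) (g : R -> R) (a : R) : 1 < g t -> is_derive t 1 g a ->
  is_derive t 1 (fun s => Defs.acosh (g s)) (a / Num.sqrt (g t ^+ 2 - 1)).
Proof.
move=> g1 ga; have p := acosh_arg_gt0 (ltW g1).
have r0 : 0 < g t * g t - 1 by rewrite subr_gt0 -expr2 exprn_egt1.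
have dr : is_derive t 1 (fun s => g s * g s - 1) (2 * a * g t).
  by derive_by ltac:(rewrite /=; ring).
have ds := is_derive_sqrt (f := fun s => g s * g s - 1) r0 dr.
have d := is_derive_comp (g := fun s => g s + Num.sqrt (g s * g s - 1))
  (is_derive1_ln (x := g t + Num.sqrt (g t * g t - 1)) p) (is_derive_add ga ds).
rewrite /Defs.acosh (_ : (fun s => _) =
  (fun s => ln (g s + Num.sqrt (g s * g s - 1))))//.
apply: is_derive_cast d _; rewrite expr2.
have s0 : Num.sqrt (g t * g t - 1) != 0 by rewrite gt_eqF ?sqrtr_gt0.
by field; rewrite s0 gt_eqF.
Qed.

End HyperbolicFunctions.

Section Hyperboloid.
Context {R : realType} (b : bool).
Notation V := 'rV[R]_3.
Notation H := (@hyperboloid R b).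

Lemma minkowski_qdot : @Defs.minkowski R = qdot (-1).
Proof.
by apply/funext => u; apply/funext => v; rewrite /Defs.minkowski /qdot mulN1r.
Qed.

Lemma hyperboloid_qdot (q : V) : H q -> qdot (-1) q q = -1.
Proof. by rewrite -minkowski_qdot => -[]. Qed.

Lemma cauchy2 (a1 a2 b1 b2 : R) :
  (a1 * b1 + a2 * b2) ^+ 2 <= (a1 ^+ 2 + a2 ^+ 2) * (b1 ^+ 2 + b2 ^+ 2).
Proof.
rewrite -subr_ge0; have -> : (a1 ^+ 2 + a2 ^+ 2) * (b1 ^+ 2 + b2 ^+ 2)
  - (a1 * b1 + a2 * b2) ^+ 2 = (a1 * b2 - a2 * b1) ^+ 2 by ring.
exact: sqr_ge0.
Qed.

Lemma hyperboloid_height (q : V) : H q -> q 0 2 ^+ 2 = 1 + (q 0 0 ^+ 2 + q 0 1 ^+ 2).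
Proof.
move=> /hyperboloid_qdot h; apply/eqP; rewrite -subr_eq0 -oppr_eq0.
by apply/eqP; rewrite -(subrr (-1 : R)) -[X in _ = X - _]h /qdot; ring.
Qed.

Lemma hyperboloid_geometry : quadric_geometry (-1) H.
Proof.
split; first by rewrite mulN1r opprK.
- exact: hyperboloid_qdot.
- move=> q [_ sq].
  (* The sign of the third coordinate persists near [q], so nearby points of the quadric are on the
     same sheet. *)
  have cc : {for q, continuous (fun p : V => (-1) ^+ b * p 0 2)}.
    apply: (@continuous_comp _ _ _ (fun p : V => p 0 2) (fun x => (-1) ^+ b * x)).
      exact: coord_continuous.
    exact: mulrl_continuous.
  have : \forall p \near q, 0 < (-1) ^+ b * (p : V) 0 2.
    apply: (cc [set x | 0 < x]).
    by apply: open_nbhs_nbhs; split; [exact: open_gt|].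
  by apply: filterS => p sp pp; split=> //; rewrite minkowski_qdot.
- move=> q w Hq qw w0; have h2 := hyperboloid_height Hq.
  have ww : qdot (-1) w w = w 0 0 ^+ 2 + w 0 1 ^+ 2 - w 0 2 ^+ 2.
    by rewrite /qdot; ring.
  have qw' : q 0 2 * w 0 2 = q 0 0 * w 0 0 + q 0 1 * w 0 1.
    by apply/eqP; rewrite -subr_eq0 -oppr_eq0 -qw /qdot; apply/eqP; ring.
  (* Cauchy-Schwarz in the first two coordinates gives [(1 + P) * w 0 2 ^+ 2 <= P * W], hence
     [(1 + P) * (W - w 0 2 ^+ 2) >= W]. *)
  have cs := cauchy2 (q 0 0) (q 0 1) (w 0 0) (w 0 1).
  rewrite -qw' exprMn h2 in cs; rewrite ww.
  set P := q 0 0 ^+ 2 + q 0 1 ^+ 2 in h2 cs *; set W := w 0 0 ^+ 2 + w 0 1 ^+ 2 in cs *.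
  have P0 : 0 <= P by rewrite addr_ge0 ?sqr_ge0.
  have [W0|W0] := eqVneq W 0.
    move: W0 => /eqP; rewrite paddr_eq0 ?sqr_ge0// !sqrf_eq0 => /andP[/eqP w00 /eqP w01].
    have q20 : q 0 2 != 0.
      by rewrite -sqrf_eq0 h2 gt_eqF// ltr_wpDr.
    case/eqP: w0; apply/rowP; apply: ord3_ind; rewrite mxE//.
    apply/eqP; move/eqP: qw'; rewrite w00 w01 !mulr0 addr0 mulf_eq0.
    by rewrite (negPf q20).
  have Wp : 0 < W by rewrite lt_def W0 addr_ge0 ?sqr_ge0.
  rewrite -(@pmulr_rgt0 _ (1 + P)) ?ltr_wpDr//.
  apply: lt_le_trans Wp _; rewrite mulrBr lerBrDr.
  have -> : (1 + P) * W = W + P * W by ring.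
  by rewrite lerD2l.
Qed.

(** [sinsq] being nonnegative bounds the square from below by 1. The sign comes from the common
    sheet: the product of the third coordinates is positive and exceeds what Cauchy-Schwarz allows
    for the other two. *)
Lemma hyperboloid_qdot_le (q Z : V) : H q -> H Z -> 1 <= - qdot (-1) q Z.
Proof.
move=> Hq HZ; have := sinsq_ge0 hyperboloid_geometry Hq HZ.
rewrite /sinsq mulN1r opprB subr_ge0 => x2.
have q2 := hyperboloid_height Hq; have Z2 := hyperboloid_height HZ.
have pos : 0 < q 0 2 * Z 0 2.
  have [_ sq] := Hq; have [_ sZ] := HZ; have := mulr_gt0 sq sZ.
  by rewrite mulrACA -expr2 sqrr_sign mul1r.
have cs := cauchy2 (q 0 0) (q 0 1) (Z 0 0) (Z 0 1).
have xpos : 0 < - qdot (-1) q Z.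
  rewrite ltNge; apply/negP => le0.
  have le : q 0 2 * Z 0 2 <= q 0 0 * Z 0 0 + q 0 1 * Z 0 1.
    by move: le0; rewrite oppr_le0 /qdot mulN1r subr_ge0.
  have : (q 0 2 * Z 0 2) ^+ 2 <= (q 0 0 * Z 0 0 + q 0 1 * Z 0 1) ^+ 2.
    by rewrite ler_sqr// nnegrE ltW// (lt_le_trans pos).
  move=> /le_trans/(_ cs); rewrite exprMn q2 Z2.
  set P := q 0 0 ^+ 2 + _; set Q := Z 0 0 ^+ 2 + _.
  have P0 : 0 <= P by rewrite addr_ge0 ?sqr_ge0.
  have Q0 : 0 <= Q by rewrite addr_ge0 ?sqr_ge0.
  apply/negP; rewrite -ltNge -subr_gt0.
  have -> : (1 + P) * (1 + Q) - P * Q = 1 + (P + Q) by ring.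
  by rewrite ltr_wpDr ?ltr01 ?addr_ge0 ?sqr_ge0.
have : 1 <= (- qdot (-1) q Z) ^+ 2 by rewrite sqrrN.
by rewrite expr_ge1// ltW.
Qed.

Lemma sn_hyperboloid (q Z : V) :
  sn (-1) q Z = Num.sqrt ((- qdot (-1) q Z) ^+ 2 - 1).
Proof. by rewrite /sn /sinsq mulN1r opprB sqrrN. Qed.

Lemma hyperboloid_neq_opp (q Z : V) : H q -> H Z -> q <> - Z.
Proof.
move=> Hq HZ qE; have := hyperboloid_qdot_le Hq HZ.
rewrite qE -(scaleN1r Z) qdotZl (hyperboloid_qdot HZ) {qE}; lra.
Qed.

Lemma sinsq_hyperboloid (q Z : V) : H q -> H Z -> 0 < sinsq (-1) q Z <-> q <> Z.
Proof.
move=> Hq HZ; rewrite (sinsq_gt0P hyperboloid_geometry)//.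
by split=> [[]|nqZ]//; split=> //; exact: hyperboloid_neq_opp.
Qed.

Lemma hyperbolic_curved_lagrange m1 m2 f (Z1 Z2 Zm : V) : H Z1 -> H Z2 -> H Zm ->
  curved_lagrange (-1) H (hyperbolic_lagrange b m1 m2 f Z1 Z2 Zm) m1 m2 f Z1 Z2 Zm.
Proof.
move=> H1 H2 Hm; split=> //.
- exact: minkowski_qdot.
- move=> q /=; split=> [[Hq r1 r2]|[Hq r1 r2 rm]]; split=> //.
  + by move=> /r1; rewrite sinsq_hyperboloid.
  + by move=> /r2; rewrite sinsq_hyperboloid.
  (* The Hooke term has no singularity here: [<q,Zm>] is at most [-1]. *)
  + by move=> _; have := hyperboloid_qdot_le Hq Hm; apply: contraTneq => ->; rewrite oppr0 ler10.
  + by move=> /r1; rewrite sinsq_hyperboloid.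
  + by move=> /r2; rewrite sinsq_hyperboloid.
- move=> q Hq /=; rewrite /Defs.coth /Defs.tanh /hyperbolic_dist minkowski_qdot !sn_hyperboloid.
  have rg (Z : V) : H Z -> 1 <= - qdot (-1) q Z by exact: hyperboloid_qdot_le.
  rewrite !sinh_acosh ?rg// !acoshK ?rg// !mulN1r -addrA exprMn exprVn sqr_sqrtr.
    by rewrite !sqrrN opprB.
  by rewrite subr_ge0 exprn_ege1 ?rg.
Qed.

Lemma hyperbolic_distance (Z1 Z2 : V) : H Z1 -> H Z2 ->
  distance_function (-1) H Z1 Z2 (@hyperbolic_dist R) (@Defs.cosh R).
Proof.
move=> H1 H2; rewrite /hyperbolic_dist minkowski_qdot.
have rg (q Z : V) : H q -> H Z -> 1 <= - qdot (-1) q Z by exact: hyperboloid_qdot_le.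
split.
- exact: coshN.
- move=> q Hq; rewrite coshD !acoshK ?rg// !sinh_acosh ?rg// !sn_hyperboloid; ring.
- move=> q Hq; rewrite coshD coshN sinhN !acoshK ?rg// !sinh_acosh ?rg// !sn_hyperboloid.
  by ring.
- move=> Z t c w HZ Hc cw h; rewrite sn_hyperboloid.
  apply: (is_derive_acosh (g := fun s => - qdot (-1) (c s) Z)).
    rewrite lt_neqAle rg// andbT; apply/negP => /eqP e1; move: h.
    by rewrite /sinsq -sqrrN -e1 expr1n subrr mulr0 ltxx.
  exact: is_derive_opp (is_derive_qdotl _ Z cw).
Qed.

Lemma hyperbolic_midpoint (Z1 Z2 Zm : V) : H Z1 -> H Z2 ->
  midpoint H (@hyperbolic_dist R) Z1 Z2 Zm ->
  Z1 + Z2 = (2 * (-1) * qdot (-1) Zm Z1) *: Zm.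
Proof.
move=> H1 H2 [Hm d1 d2]; rewrite /hyperbolic_dist minkowski_qdot in d1 d2.
have ck (q Z : V) : H q -> H Z -> Defs.cosh (Defs.acosh (- qdot (-1) q Z)) = - qdot (-1) q Z.
  by move=> Hq HZ; rewrite acoshK// hyperboloid_qdot_le.
apply: (midpoint_sum hyperboloid_geometry) => //.
  by apply: oppr_inj; rewrite -(ck Zm Z1)// -(ck Zm Z2)// d1 d2.
rewrite -sqrrN -(ck Zm Z1)// d1 mulN1r -[in RHS](ck Z1 Z2)//.
set a := Defs.acosh _; rewrite [in RHS](splitr a) coshD -!expr2 sqr_cosh; ring.
Qed.

Theorem hyperbolic_integrable (m1 m2 f : R) (Z1 Z2 Zm : V) (B : wall R 3) :
  H Z1 -> H Z2 -> Z1 <> Z2 ->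
  midpoint H (@hyperbolic_dist R) Z1 Z2 Zm ->
  confocal_combination H (@hyperbolic_dist R) Z1 Z2 B ->
  integrable_billiard (hyperbolic_lagrange b m1 m2 f Z1 Z2 Zm) B.
Proof.
move=> H1 H2 n12 mid conB; have [Hm _ _] := mid.
have Zsum := hyperbolic_midpoint H1 H2 mid.
have k0 : 2 * (-1) * qdot (-1) Zm Z1 != 0.
  by have := hyperboloid_qdot_le Hm H1 => h; apply/eqP; lra.
have Zind : 0 < sinsq (-1) Z1 Z2 by apply/sinsq_hyperboloid.
exact: (curved_integrable hyperboloid_geometry
  (hyperbolic_curved_lagrange m1 m2 f H1 H2 Hm)
  H1 H2 Hm Zsum k0 Zind (hyperbolic_distance H1 H2)).
Qed.

End Hyperboloid.

(** * The plane *)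

Section PlaneVectors.
Context {R : realType}.
Notation V := 'rV[R]_2.
Implicit Types (u v w : V).

Definition wedge u v : R := u 0 0 * v 0 1 - u 0 1 * v 0 0.

Definition perp u : V := \row_i if i == 0 then - u 0 1 else u 0 0.

Lemma dot2E u v : dot u v = u 0 0 * v 0 0 + u 0 1 * v 0 1.
Proof.
rewrite /dot !big_ord_recl big_ord0 addr0.
by rewrite (_ : lift ord0 ord0 = 1); last exact: val_inj.
Qed.

Lemma dot_perp u v : dot v (perp u) = wedge u v.
Proof. by rewrite dot2E /wedge !mxE/=; ring. Qed.

Lemma wedge_perp u v : wedge u (perp v) = dot u v.
Proof. by rewrite dot2E /wedge !mxE/=; ring. Qed.

Lemma dot_ge0 u : 0 <= dot u u.
Proof. by rewrite dot2E addr_ge0// -expr2 sqr_ge0. Qed.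

Lemma dot_gt0 u : u != 0 -> 0 < dot u u.
Proof.
move=> u0; rewrite lt_def dot_ge0 andbT; apply: contra_neq u0 => /eqP.
rewrite dot2E -!expr2 paddr_eq0 ?sqr_ge0// !sqrf_eq0 => /andP[/eqP u0 /eqP u1].
apply/rowP => -[[|[|//]] Hi]; rewrite mxE.
- by rewrite -[RHS]u0; congr (u _ _); exact: val_inj.
- by rewrite -[RHS]u1; congr (u _ _); exact: val_inj.
Qed.

Lemma is_derive_dot (t : R) (c b : R -> V) w u :
  is_derive t 1 c w -> is_derive t 1 b u ->
  is_derive t 1 (fun s => dot (c s) (b s)) (dot w (b t) + dot (c t) u).
Proof.
move=> cw bu; rewrite (_ : (fun s => _) =
  (fun s => c s 0 0 * b s 0 0 + c s 0 1 * b s 0 1)); last first.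
  by apply/funext => s; rewrite dot2E.
by derive_by ltac:(rewrite /= !dot2E; ring).
Qed.

Lemma is_derive_wedge (t : R) (c b : R -> V) w u :
  is_derive t 1 c w -> is_derive t 1 b u ->
  is_derive t 1 (fun s => wedge (c s) (b s)) (wedge w (b t) + wedge (c t) u).
Proof.
move=> cw bu; rewrite /wedge.
by derive_by ltac:(rewrite /=; ring).
Qed.

Lemma is_derive_subr (t : R) (c : R -> V) w u :
  is_derive t 1 c w -> is_derive t 1 (fun s => c s - u) w.
Proof.
move=> cw; apply/is_derive_rowP => i; under eq_fun do rewrite !mxE.
by derive_by ltac:(rewrite /= addr0).
Qed.

Lemma euclid_norm_sqr u : euclid_norm u ^+ 2 = dot u u.
Proof. by rewrite sqr_sqrtr// dot_ge0. Qed.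

Lemma euclid_norm_gt0 u : u != 0 -> 0 < euclid_norm u.
Proof. by move=> u0; rewrite sqrtr_gt0 dot_gt0. Qed.

Lemma is_derive_norm (t : R) (c : R -> V) w :
  is_derive t 1 c w -> c t != 0 ->
  is_derive t 1 (fun s => euclid_norm (c s)) (dot (c t) w / euclid_norm (c t)).
Proof.
move=> cw c0; have n0 := euclid_norm_gt0 c0.
apply: is_derive_cast (is_derive_sqrt (f := fun s => dot (c s) (c s)) (dot_gt0 c0)
  (is_derive_dot cw cw)) _.
rewrite -/(euclid_norm (c t)) !dot2E; field.
by rewrite gt_eqF.
Qed.

End PlaneVectors.

Section PlaneLagrange.
Context {R : realType} (m1 m2 f : R) (Z1 Z2 : 'rV[R]_2).
Notation V := 'rV[R]_2.
Hypothesis n12 : Z1 <> Z2.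
Notation S := (plane_lagrange m1 m2 f Z1 Z2).

Let mid : V := 2^-1 *: (Z1 + Z2).
Let axis : V := 2^-1 *: (Z1 - Z2).

Lemma plane_tangent (q w : V) : tangent setT q w.
Proof.
exists (fun s : R => q + s *: w); split; last exact: is_derive_affine.
  by rewrite scale0r addr0.
exact: (@filterE _ (nbhs (0 : R))).
Qed.

Lemma is_derive_newton (t : R) (c : R -> V) w : is_derive t 1 c w -> c t != 0 ->
  is_derive t 1 (fun s => (euclid_norm (c s))^-1)
    (- dot (c t) w / euclid_norm (c t) ^+ 3).
Proof.
move=> cw c0; have n0 : euclid_norm (c t) != 0 by rewrite gt_eqF// euclid_norm_gt0.
apply: is_derive_cast (is_derive_inv (f := fun s => euclid_norm (c s)) n0
  (is_derive_norm cw c0)) _.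
by field.
Qed.

Definition plane_gradient (q : V) : V :=
  - (m1 / euclid_norm (q - Z1) ^+ 3) *: (q - Z1)
  - (m2 / euclid_norm (q - Z2) ^+ 3) *: (q - Z2) + (2 * f) *: (q - mid).

Let sub_neq0 (m : R) (q Z : V) : (m != 0 -> q <> Z) -> m != 0 -> q - Z != 0.
Proof. by move=> h /h nqZ; rewrite subr_eq0; exact/eqP. Qed.

Lemma is_derive_plane_force (q w : V) : regular S q ->
  is_derive (0 : R) 1 (force S \o (fun s : R => q + s *: w)) (dot (plane_gradient q) w).
Proof.
move=> [/sub_neq0 r1 /sub_neq0 r2]; pose c (s : R) := q + s *: w.
have c0 : c 0 = q by rewrite /c scale0r addr0.
have cw Z : is_derive (0 : R) 1 (fun s => c s - Z) w.
  by apply: is_derive_subr; exact: is_derive_affine.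
rewrite -c0 in r1 r2.
have K1 := is_derive_scaled (fun h => is_derive_newton (cw Z1) (r1 h)).
have K2 := is_derive_scaled (fun h => is_derive_newton (cw Z2) (r2 h)).
have HK := is_derive_mul (is_derive_const 0 f) (is_derive_dot (cw mid) (cw mid)).
rewrite (_ : _ \o _ = fun s => m1 * (euclid_norm (c s - Z1))^-1
    + m2 * (euclid_norm (c s - Z2))^-1 + f * dot (c s - mid) (c s - mid)); last first.
  by apply/funext => s; rewrite /= euclid_norm_sqr.
apply: is_derive_cast (is_derive_add (is_derive_add K1 K2) HK) _.
by rewrite c0 /plane_gradient !dot2E !mxE; ring.
Qed.

Lemma plane_acceleration (J : set R) q t w : open J -> solution S J q -> J t ->
  dot (derive1 (derive1 q) t) w = dot (plane_gradient (q t)) w.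
Proof.
move=> oJ sol Jt; have [rq _ _ [a [[_ cov] [_ grad]]]] := sol t Jt.
have cc : curve_at setT (q t) w (fun s : R => q t + s *: w).
  split; [by rewrite scale0r addr0 | exact: (@filterE _ (nbhs (0 : R))) |].
  exact: is_derive_affine.
have [_ <-] := is_derive_plane_force w rq; have [_ ->] := grad w _ cc.
have /= := cov w (plane_tangent _ _); rewrite !dot2E !mxE => /eqP.
by rewrite -subr_eq0 => /eqP h; apply/eqP; rewrite -subr_eq0; apply/eqP; rewrite -[RHS]h; ring.
Qed.

(** [-2 *: axis] and [2 *: axis] lead from each center to the other one, so the Kepler terms have
    the same meaning as on a quadric; [wedge (p.1 - mid) axis] is the signed distance to the line
    through the foci, times half the focal distance. *)
Definition plane_integral (p : V * V) : R :=
  wedge (p.1 - Z1) p.2 * wedge (p.1 - Z2) p.2 +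
  (m1 * (- 2 * (dot (p.1 - Z1) axis * (euclid_norm (p.1 - Z1))^-1)) +
   (m2 * (2 * (dot (p.1 - Z2) axis * (euclid_norm (p.1 - Z2))^-1)) +
    f * (2 * (wedge (p.1 - mid) axis * wedge (p.1 - mid) axis)))).

(** Rests on [dot v u * dot c c - dot c u * dot c v = wedge c v * wedge c u]. *)
Lemma is_derive_newton_integral (t : R) (c : R -> V) (v u : V) :
  is_derive t 1 c v -> c t != 0 ->
  is_derive t 1 (fun s => dot (c s) u * (euclid_norm (c s))^-1)
    (wedge (c t) v * wedge (c t) u / euclid_norm (c t) ^+ 3).
Proof.
move=> cv c0; have n0 : euclid_norm (c t) != 0 by rewrite gt_eqF// euclid_norm_gt0.
apply: is_derive_cast (is_derive_mul (is_derive_dot cv (is_derive_cst u t 1))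
  (is_derive_newton cv c0)) _.
have n2 := euclid_norm_sqr (c t).
transitivity ((dot v u * euclid_norm (c t) ^+ 2 - dot (c t) u * dot (c t) v)
  / euclid_norm (c t) ^+ 3).
  by rewrite (_ : dot (c t) 0 = 0); [field | rewrite dot2E !mxE; ring].
by rewrite n2 /wedge !dot2E; congr (_ / _); ring.
Qed.

Lemma plane_integral_constant (J : set R) (q : R -> V) : open J ->
  is_interval J -> solution S J q -> forall s t, J s -> J t ->
  plane_integral (q s, derive1 q s) = plane_integral (q t, derive1 q t).
Proof.
move=> oJ iJ sol; apply: (is_derive0_interval
  (f := fun s => plane_integral (q s, derive1 q s))) => // t Jt.
have [rq dq ddq _] := sol t Jt; have [/sub_neq0 r1 /sub_neq0 r2] := rq.
have qv : is_derive t 1 q (derive1 q t) by exact: is_derive_derive1.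
have va : is_derive t 1 (derive1 q) (derive1 (derive1 q) t) by exact: is_derive_derive1.
have qvZ Z := is_derive_subr Z qv.
have dL Z : is_derive t 1 (fun s => wedge (q s - Z) (derive1 q s))
    (wedge (q t - Z) (plane_gradient (q t))).
  apply: is_derive_cast (is_derive_wedge (qvZ Z) va) _.
  (* With its first argument fixed, [wedge] is the pairing with a vector turned by a right angle, so
     the equation of motion applies; the other term is [wedge] of the velocity with itself. *)
  rewrite -[RHS]dot_perp -(plane_acceleration _ oJ sol Jt) dot_perp.
  by rewrite [X in X + _](_ : _ = 0) ?add0r// /wedge; ring.
have LL := is_derive_mul (dL Z1) (dL Z2).
have K1 := is_derive_scaled (fun h => is_derive_mul (is_derive_const t (- 2))
  (is_derive_newton_integral axis (qvZ Z1) (r1 h))).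
have K2 := is_derive_scaled (fun h => is_derive_mul (is_derive_const t 2)
  (is_derive_newton_integral axis (qvZ Z2) (r2 h))).
have dW := is_derive_wedge (qvZ mid) (is_derive_cst axis t 1).
have HK := is_derive_mul (is_derive_const t f)
  (is_derive_mul (is_derive_const t 2) (is_derive_mul dW dW)).
apply: is_derive_cast (is_derive_add LL (is_derive_add K1 (is_derive_add K2 HK))) _.
move: (derive1 q t) (q t) => v p /=; rewrite /plane_gradient.
move: (_ ^+ 3)^-1 (_ ^+ 3)^-1 => i1 i2; rewrite !mul0r !add0r.
by rewrite /wedge /mid /axis !mxE; field.
Qed.

Lemma smooth_plane_integral : smooth_near (phase S) plane_integral.
Proof.
have sd Z u : smooth_near (phase S) (fun p => dot (p.1 - Z) u).
  rewrite (_ : (fun p => _) = (fun p : V * V => (p.1 0 0 - Z 0 0) * u 0 0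
    + (p.1 0 1 - Z 0 1) * u 0 1)); first by smooth_rules.
  by apply/funext => p; rewrite dot2E !mxE.
have sw Z u : smooth_near (phase S) (fun p => wedge (p.1 - Z) u).
  by rewrite /wedge; under eq_fun do rewrite !mxE; smooth_rules.
have sL Z : smooth_near (phase S) (fun p => wedge (p.1 - Z) p.2).
  by rewrite /wedge; under eq_fun do rewrite !mxE; smooth_rules.
have sn Z : (forall p, phase S p -> p.1 - Z != 0) ->
    smooth_near (phase S) (fun p => (euclid_norm (p.1 - Z))^-1).
  move=> h; apply: smooth_nearV => [p /h /euclid_norm_gt0 /lt0r_neq0//|].
  apply: smooth_near_sqrt => [p /h /dot_gt0//|].
  rewrite (_ : (fun p => _) = (fun p : V * V => (p.1 0 0 - Z 0 0) * (p.1 0 0 - Z 0 0)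
    + (p.1 0 1 - Z 0 1) * (p.1 0 1 - Z 0 1))); first by smooth_rules.
  by apply/funext => p; rewrite dot2E !mxE.
rewrite /plane_integral; apply: smooth_nearD; first exact: smooth_nearM.
apply: smooth_nearD; last apply: smooth_nearD.
- apply: smooth_near_scaled => h.
  have sn1 := sn Z1 (fun p pp => sub_neq0 pp.1.1 h); have s1 := sd Z1 axis.
  by smooth_rules.
- apply: smooth_near_scaled => h.
  have sn2 := sn Z2 (fun p pp => sub_neq0 pp.1.2 h); have s2 := sd Z2 axis.
  by smooth_rules.
- have s0 := sw mid axis; apply: smooth_nearM; last by smooth_rules.
  exact: smooth_near_cst.
Qed.

(** * Reflections at confocal conics in the plane *)

Section PlaneReflection.
Variable B : wall R 2.
Hypothesis conB : confocal_combination setT (@euclid_dist R 2) Z1 Z2 B.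

(** [confocal_reflection] with [psi] the square: by the law of cosines, comparing [(d1 + d2) ^+ 2]
    or [(d1 - d2) ^+ 2] with the squared focal distance determines [k]. Here [eta = 1], as the
    vectors [q - Z_i] point away from the foci. *)
Lemma plane_mirror_condition (i : wall_piece B) t : wall_dom i t ->
  let q := wall_map i t in let e := derive1 (wall_map i) t in
  0 < dot e e /\
  dot e (q - Z1) * wedge (q - Z2) e + dot e (q - Z2) * wedge (q - Z1) e = 0.
Proof.
have [[arcB _] con] := conB; move=> Jt.
have [iJ Jne [W [_ JW smW]] JM] := arcB i.
have [_ en0] := JM t Jt.
have ce : is_derive t 1 (wall_map i) (derive1 (wall_map i) t).
  apply: is_derive_derive1; apply: diff_derivable.
  by have [dW _] := smW 1%N; exact/dW/JW.
set c := wall_map i in en0 ce *; set e := derive1 c t in en0 ce *.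
have E0 := dot_gt0 en0; split=> //=.
have ceZ Z := is_derive_subr Z ce.
have dd Z : 0 < euclid_norm (c t - Z) -> is_derive t 1 (fun s => euclid_dist (c s) Z)
    (1 * dot e (c t - Z) / euclid_norm (c t - Z)).
  rewrite sqrtr_gt0 => h; have cZ : c t - Z != 0.
    by apply: contraTneq h => ->; rewrite dot2E !mxE !mul0r addr0 ltxx.
  apply: is_derive_cast (is_derive_norm (ceZ Z) cZ) _.
  by rewrite mul1r; congr (_ / _); rewrite !dot2E; ring.
have N Z : dot e (c t - Z) ^+ 2 + wedge (c t - Z) e ^+ 2 =
    dot e e * euclid_norm (c t - Z) ^+ 2.
  by rewrite euclid_norm_sqr !dot2E /wedge; ring.
apply: (@confocal_reflection R (wall_dom i) t
  (fun s => euclid_dist (c s) Z1) (fun s => euclid_dist (c s) Z2)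
  (fun s => dot (c s - Z1) (c s - Z2))
  (fun s => euclid_norm (c s - Z1)) (fun s => euclid_norm (c s - Z2))
  (fun s => wedge (c s - Z1) (c s - Z2)) (fun x => x ^+ 2) (dot (Z1 - Z2) (Z1 - Z2))
  (dot e (c t - Z1)) (dot e (c t - Z2)) (wedge (c t - Z1) e) (wedge (c t - Z2) e)
  (dot e e) 1 (wedge e (c t - Z2) + wedge (c t - Z1) e)
  iJ Jne Jt E0 _ _ _ (dd Z1) (dd Z2) (N Z1) (N Z2) _ (is_derive_wedge (ceZ Z1) (ceZ Z2))).
- exact: oner_neq0.
- exact: sqrrN.
- move=> u _; have n1 := euclid_norm_sqr (c u - Z1); have n2 := euclid_norm_sqr (c u - Z2).
  have sum : dot (Z1 - Z2) (Z1 - Z2) =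
      euclid_norm (c u - Z1) ^+ 2 + euclid_norm (c u - Z2) ^+ 2
      - 2 * dot (c u - Z1) (c u - Z2).
    by rewrite n1 n2 !dot2E !mxE; ring.
  split; [exact: sqrtr_ge0|exact: sqrtr_ge0| | |].
  + by rewrite exprMn n1 n2 !dot2E /wedge !mxE; ring.
  + rewrite sum /euclid_dist; move: (euclid_norm _) (euclid_norm _) (dot _ _) => x y z.
    by split=> [h|->]; [lra | ring].
  + rewrite sum /euclid_dist; move: (euclid_norm _) (euclid_norm _) (dot _ _) => x y z.
    by split=> [h|->]; [lra | ring].
- by rewrite !dot2E /wedge; ring.
(* [D = 0] puts the point on the line through the foci, and [D' = 0] makes the arc tangent to that
   line. *)
- move=> D0 D'0; have W2 : wedge (c t - Z2) e = 0.
    have /eqP : dot (Z1 - Z2) (Z1 - Z2) * wedge (c t - Z2) e = 0.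
      transitivity (dot (Z1 - Z2) e * wedge (c t - Z1) (c t - Z2)
        - dot (Z1 - Z2) (c t - Z2) * (wedge e (c t - Z2) + wedge (c t - Z1) e)).
        by rewrite !dot2E /wedge !mxE; ring.
      by rewrite D0 D'0 !mulr0 subrr.
    rewrite mulf_eq0 gt_eqF; first by move/eqP.
    by apply: dot_gt0; rewrite subr_eq0; exact/eqP.
  split=> //; rewrite -D'0 -[LHS]add0r -[X in X + _]oppr0 -[X in - X + _]W2.
  by rewrite /wedge; ring.
- have [C [cc conC] JC] := con i; exists cc.
  by case: conC => CE; [left | right] => u /JC; rewrite CE => -[].
Qed.

Lemma reflection_plane_integral : reflection_invariant S B plane_integral.
Proof.
move=> i t v Jt _; have := plane_mirror_condition Jt.
set q := wall_map i t; set e := derive1 (wall_map i) t => -[E0 mir].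
rewrite /plane_integral /=; congr (_ + _); rewrite /reflection /tangential.
set E := dot e e in E0 *; set w := (_ / E) *: e - _.
have E_neq0 : E != 0 by rewrite gt_eqF.
have wE Z : wedge (q - Z) w = 2 * (dot v e / E) * wedge (q - Z) e - wedge (q - Z) v.
  by rewrite /w /wedge !mxE; ring.
have L Z : wedge (q - Z) v =
    (wedge (q - Z) e * dot v e + wedge e v * dot e (q - Z)) / E.
  by apply/(canRL (mulfK E_neq0)); rewrite /E !dot2E /wedge; ring.
rewrite !wE !L; move: mir; set A1 := dot e (q - Z1); set A2 := dot e (q - Z2).
set B1 := wedge (q - Z1) e; set B2 := wedge (q - Z2) e; set a := dot v e; set d := wedge e v.
move=> mir; apply/eqP; rewrite -subr_eq0.
have -> : (2 * (a / E) * B1 - (B1 * a + d * A1) / E) * (2 * (a / E) * B2 - (B2 * a + d * A2) / E)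
  - (B1 * a + d * A1) / E * ((B2 * a + d * A2) / E) =
  - 2 * a * d / E ^+ 2 * (A1 * B2 + A2 * B1) by field.
by rewrite mir mulr0.
Qed.

End PlaneReflection.

(** * Independence of the energy in the plane *)

Definition plane_rotation_derivative (q v : V) : R :=
  dot (q - Z1) v * wedge (q - Z2) v + wedge (q - Z1) v * dot (q - Z2) v.

Lemma plane_phaseP (q v : V) : phase S (q, v) <-> regular S q.
Proof. by split=> [[]//|rq]; split=> //; exact: plane_tangent. Qed.

Lemma plane_vertical_curve (q v w : V) : phase S (q, v) ->
  let c (s : R) := (q, v + s *: w) in
  [/\ curve_at (phase S) (q, v) (0, w) c,
    is_derive (0 : R) 1 (energy S \o c) (dot v w) &
    is_derive (0 : R) 1 (plane_integral \o c)
      (wedge (q - Z1) w * wedge (q - Z2) v + wedge (q - Z1) v * wedge (q - Z2) w)].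
Proof.
move=> /plane_phaseP rq c.
have dw := is_derive_affine v w; have dq Z := is_derive_cst (q - Z) (0 : R) 1.
have c0 : v + 0 *: w = v by rewrite scale0r addr0.
split.
- split; first by rewrite /c c0.
    by apply: (@filterE _ (nbhs (0 : R))) => s; exact/plane_phaseP.
  rewrite (_ : c = fun s => (q, v) + s *: (0, w)); first exact: is_derive_affine.
  by apply/funext => s; congr pair; rewrite /= scaler0 addr0.
- rewrite /comp /energy /c /=.
  have dE := is_derive_dot dw dw; rewrite c0 in dE.
  notypeclasses refine (is_derive_cast _ _); first by derive_rules.
  by rewrite /= !dot2E; field.
- rewrite /comp /plane_integral /c /=.
  have d1 := is_derive_wedge (dq Z1) dw; have d2 := is_derive_wedge (dq Z2) dw.
  notypeclasses refine (is_derive_cast _ _); first by derive_rules.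
  by rewrite /= c0 /wedge !mxE; ring.
Qed.

Lemma plane_independent_at_rotation (q v : V) : phase S (q, v) ->
  plane_rotation_derivative q v != 0 ->
  independent_at S (energy S) plane_integral (q, v).
Proof.
move=> pqv rot.
(* As on a quadric, the variations are a rotation, which preserves the energy, and a scaling. *)
have [c1 E1 G1] := plane_vertical_curve (perp v) pqv.
have [c2 E2 G2] := plane_vertical_curve v pqv.
do 8!eexists; split; [exact: c1 | exact: c2 | split; [exact: E1 | exact: G1]
  | split; [exact: E2 | exact: G2] | ].
rewrite !wedge_perp dot_perp (_ : wedge v v = 0); last by rewrite /wedge; ring.
rewrite mul0r sub0r oppr_eq0 mulf_neq0//; apply/lt0r_neq0/dot_gt0.
apply: contra_neq rot => ->.
by rewrite /plane_rotation_derivative /wedge !mxE; ring.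
Qed.

Lemma plane_independent_dense_at (q v : V) : phase S (q, v) ->
  wedge (q - Z1) (q - Z2) != 0 ->
  closure [set p | phase S p /\ independent_at S (energy S) plane_integral p] (q, v).
Proof.
(* For a velocity along the line to [Z1] the rotation derivative is
   [- dot w w * wedge (q - Z1) (q - Z2)], the leading coefficient in [s]. *)
move=> pqv D0; pose w := q - Z1.
pose b := dot w v * wedge (q - Z2) w + dot w w * wedge (q - Z2) v
  + wedge w v * dot (q - Z2) w.
have rotE s : plane_rotation_derivative q (v + s *: w) =
    plane_rotation_derivative q w * s ^+ 2 + b * s + plane_rotation_derivative q v.
  by rewrite /b /plane_rotation_derivative -/w !dot2E /wedge !mxE; ring.
have w0 : plane_rotation_derivative q w != 0.
  have -> : plane_rotation_derivative q w = - (dot w w * wedge (q - Z1) (q - Z2)).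
    by rewrite /plane_rotation_derivative -/w /wedge; ring.
  rewrite oppr_eq0 mulf_neq0//; apply/lt0r_neq0/dot_gt0.
  by apply: contra_neq D0; rewrite -/w => ->; rewrite /wedge !mxE; ring.
have := @closure_punctured R _ [set p | phase S p /\ independent_at S (energy S) plane_integral p]
  (fun s => (q, v + s *: w)).
rewrite scale0r addr0; apply.
  have [[_ _ cw] _ _] := plane_vertical_curve w pqv.
  exact: is_derive_continuous cw.
have := quadratic_neq0_near b (plane_rotation_derivative q v) w0; apply: filterS => s rs /=.
have ps : phase S (q, v + s *: w) by apply/plane_phaseP; case: pqv.
by split=> //; apply: plane_independent_at_rotation => //; rewrite rotE.
Qed.

Lemma plane_noncollinear_dense (q v : V) : phase S (q, v) ->
  closure [set p | phase S p /\ wedge (p.1 - Z1) (p.1 - Z2) != 0] (q, v).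
Proof.
move=> pqv; have [D0|D0] := eqVneq (wedge (q - Z1) (q - Z2)) 0; last exact: subset_closure.
have [[r1 r2] _] := pqv.
(* Moving normally to the line through the foci changes the wedge at the rate
   [- dot (Z1 - Z2) (Z1 - Z2)]. *)
pose n := perp (Z1 - Z2); pose c (s : R) : V := q + s *: n.
have c0 : c 0 = q by rewrite /c scale0r addr0.
have cn : is_derive (0 : R) 1 c n by exact: is_derive_affine.
have cnZ Z := is_derive_subr Z cn.
rewrite -[q]c0; apply: (closure_punctured (c := fun s => (c s, v))).
  by apply: continuous_at_pair; [exact: is_derive_continuous cn | exact: cvg_cst].
have dD := is_derive_wedge (cnZ Z1) (cnZ Z2).
have DN : wedge n (c 0 - Z2) + wedge (c 0 - Z1) n != 0.
  have -> : wedge n (c 0 - Z2) + wedge (c 0 - Z1) n = - dot (Z1 - Z2) (Z1 - Z2).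
    by rewrite /n /perp dot2E /wedge !mxE/=; ring.
  rewrite oppr_eq0; apply/lt0r_neq0/dot_gt0.
  by rewrite subr_eq0; exact/eqP.
have D00 : wedge (c 0 - Z1) (c 0 - Z2) = 0 by rewrite c0.
have := is_derive_neq0_near dD D00 DN; apply: filterS => s Ds; split=> //.
(* At a center the wedge vanishes, so positions where it is nonzero are regular. *)
apply/plane_phaseP; split=> _ cZ; move: Ds; rewrite /= cZ subrr.
  by rewrite /wedge !mxE !mul0r subrr eqxx.
by rewrite /wedge !mxE !mulr0 subrr eqxx.
Qed.

Lemma plane_independent : functionally_independent S (energy S) plane_integral.
Proof.
move=> [q v] pqv.
have sub : [set p | phase S p /\ wedge (p.1 - Z1) (p.1 - Z2) != 0] `<=`
    closure [set p | phase S p /\ independent_at S (energy S) plane_integral p].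
  by move=> [q' v'] [pqv' D0]; exact: plane_independent_dense_at.
have := closureS sub (plane_noncollinear_dense pqv).
by rewrite -(closure_id _).1//; exact: closed_closure.
Qed.

Theorem plane_integrable (B : wall R 2) :
  confocal_combination setT (@euclid_dist R 2) Z1 Z2 B -> integrable_billiard S B.
Proof.
move=> conB; exists plane_integral; split; last exact: plane_independent.
- by split; [exact: smooth_plane_integral | exact: plane_integral_constant].
- exact: reflection_plane_integral conB.
Qed.

End PlaneLagrange.

Theorem theorem1 (R : realType) (m1 m2 f : R) :
  (forall (Z1 Z2 : 'rV[R]_2) (B : wall R 2),
     Z1 <> Z2 ->
     confocal_combination [set: 'rV[R]_2] (@euclid_dist R 2) Z1 Z2 B ->
     integrable_billiard (plane_lagrange m1 m2 f Z1 Z2) B)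
  /\
  (forall (Z1 Z2 Zm : 'rV[R]_3) (B : wall R 3),
     sphere Z1 -> sphere Z2 -> Z2 <> Z1 -> Z2 <> - Z1 ->
     midpoint (@sphere R) (@sphere_dist R) Z1 Z2 Zm ->
     confocal_combination (@sphere R) (@sphere_dist R) Z1 Z2 B ->
     integrable_billiard (sphere_lagrange m1 m2 f Z1 Z2 Zm) B)
  /\
  (forall (s : bool) (Z1 Z2 Zm : 'rV[R]_3) (B : wall R 3),
     hyperboloid s Z1 -> hyperboloid s Z2 -> Z1 <> Z2 ->
     midpoint (@hyperboloid R s) (@hyperbolic_dist R) Z1 Z2 Zm ->
     confocal_combination (@hyperboloid R s) (@hyperbolic_dist R) Z1 Z2 B ->
     integrable_billiard (hyperbolic_lagrange s m1 m2 f Z1 Z2 Zm) B).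
Proof.
split; last split.
- by move=> Z1 Z2 B n12; exact: plane_integrable.
- by move=> Z1 Z2 Zm B *; exact: sphere_integrable.
- by move=> s Z1 Z2 Zm B *; exact: hyperbolic_integrable.
Qed.
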